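(* Let $\Gamma \leq \mathrm{Homeo}_+(I)$ be a subgroup with $\mathcal{M}(\Gamma)=(0,1)$ such that every non-identity element of $\Gamma$ has at most $3$ fixed points in $(0,1)$. Then $\Gamma$ is semi-conjugate to an affine group, i.e. to a subgroup of $\mathrm{Aff}_+(\mathbb{R})$.
   Context: $I=[0,1]$; $\mathrm{Homeo}_+(X)$ is the group of orientation preserving homeomorphisms of $X$. Subgroups of $\mathrm{Homeo}_+(I)$ are viewed as subgroups of $\mathrm{Homeo}_+(\mathbb{R})$ by restricting to $(0,1)$ and identifying $(0,1)$ with $\mathbb{R}$ by an orientation preserving homeomorphism. $\mathrm{Aff}_+(\mathbb{R})$ is the group of orientation preserving affine homeomorphisms of $\mathbb{R}$. A minimal set of $\Gamma$ is a non-empty closed (in $(0,1)$) $\Gamma$-invariant subset of $(0,1)$ containing no proper non-empty closed $\Gamma$-invariant subset; $\mathcal{M}(\Gamma)=(0,1)$ means that $(0,1)$ itself is the (then unique) minimal set, i.e. every orbit of $\Gamma$ in $(0,1)$ is dense. Semi-conjugacy is in the usual sense: $G\leq\mathrm{Homeo}_+(\mathbb{R})$ is semi-conjugate to $G_1\leq\mathrm{Homeo}_+(\mathbb{R})$ if there are a surjective homomorphism $\rho:G\to G_1$ and a continuous non-decreasing surjective map $\theta:\mathbb{R}\to\mathbb{R}$ with $\theta\circ g=\rho(g)\circ\theta$ for all $g\in G$. *)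

(* Defs.v *)
From HB Require Import structures.
From mathcomp Require Import all_boot all_order all_algebra.
From mathcomp Require Import all_classical all_reals all_analysis.
From mathcomp Require Import ring lra.

Set Implicit Arguments.
Unset Strict Implicit.
Unset Printing Implicit Defensive.

Import Order.TTheory GRing.Theory Num.Theory.
Import numFieldNormedType.Exports.

Local Open Scope classical_set_scope.
Local Open Scope ring_scope.

HB.instance Definition _ (X : Type) (A : set X) :=
  SubType.copy (set_type A) {x | x \in A}.

HB.instance Definition _ d (X : porderType d) (A : set X) :=
  [SubChoice_isSubPOrder of set_type A by <: with d].

HB.instance Definition _ d (X : POrderedTopological.type d) (A : set X) :=
  Order.POrder.on (set_type A).

Definition Homeo_plus dX dY (X : POrderedTopological.type dX)
    (Y : POrderedTopological.type dY) : set (X -> Y) :=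
  [set f : X -> Y | [/\ {homo f : x y / (x < y)%O}, continuous f &
     exists g : Y -> X, [/\ cancel f g, cancel g f & continuous g]]].
Arguments Homeo_plus {dX dY} X Y.

Definition homeo_subgroup d (X : POrderedTopological.type d)
    (G : set (X -> X)) : Prop :=
  [/\ G `<=` Homeo_plus X X,
      G id,
      forall f g, G f -> G g -> G (f \o g) &
      forall f g, G f -> cancel f g -> cancel g f -> G g].

(* The action on [Y] induced by [G] through an injection [e : Y -> X] with
   [G]-invariant range: the restriction of [G] to [Y] when [e] is an inclusion,
   and the conjugate of [G] by [e] when [e] is a homeomorphism. *)
Definition pullback_action (X Y : Type) (e : Y -> X) (G : set (X -> X)) :
  set (Y -> Y) := [set h : Y -> Y | exists2 g, G g & e \o h = g \o e].

Definition invariant_set (X : Type) (G : set (X -> X)) (S : set X) : Prop :=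
  forall g, G g -> g @` S `<=` S.

Definition minimal_set (X : topologicalType) (G : set (X -> X)) (M : set X) :
    Prop :=
  [/\ M !=set0, closed M, invariant_set G M &
      forall N : set X, N !=set0 -> closed N -> invariant_set G N -> ~ (N `<` M)].

Notation unit_cc R := (set_type (`[0%R, 1%R]%classic : set R)).
Notation unit_oo R := (set_type (`]0%R, 1%R[%classic : set R)).

Lemma mem_oo_cc (R : realType) (x : R) :
  x \in `]0, 1[%classic -> x \in `[0, 1]%classic.
Proof. by rewrite !inE => /subset_itv_oo_cc. Qed.

Definition incl_oo_cc (R : realType) (x : unit_oo R) : unit_cc R :=
  exist _ (val x) (mem_oo_cc (valP x)).

Definition Aff_plus (R : realType) : set (R -> R) :=
  [set f : R -> R | Homeo_plus R R f /\ exists a b : R, f = (fun x => a * x + b)].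

Definition semiconjugate (R : realType) (G G1 : set (R -> R)) : Prop :=
  exists (rho : (R -> R) -> (R -> R)) (theta : R -> R),
    [/\ rho @` G = G1,
        forall f g, G f -> G g -> rho (f \o g) = rho f \o rho g,
        [/\ continuous theta, {homo theta : x y / x <= y} &
            range theta = setT] &
        forall g, G g -> theta \o g = rho g \o theta].

Section identification.
Variable R : realType.

Let s (u : R) : R := (1 + u / (1 + `|u|)) / 2.
Let t (y : R) : R := (2 * y - 1) / (1 - `|2 * y - 1|).

Let s_oo u : s u \in `]0, 1[%classic.
Proof.
rewrite inE /= in_itv /= /s.
have h : 0 < 1 + `|u| by rewrite ltr_wpDr.
have : `|u / (1 + `|u|)| < 1.
  by rewrite normrM normfV (gtr0_norm h) ltr_pdivrMr// mul1r ltrDr ltr01.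
rewrite ltr_norml => /andP[h1 h2]; apply/andP; split; lra.
Qed.

Let psi (u : R) : unit_oo R := exist _ (s u) (s_oo u).

Let sK : cancel s t.
Proof.
move=> u; rewrite /t /s.
have h : 0 < 1 + `|u| by rewrite ltr_wpDr.
have -> : 2 * ((1 + u / (1 + `|u|)) / 2) - 1 = u / (1 + `|u|) by field; lra.
rewrite normrM normfV (gtr0_norm h); field; lra.
Qed.

Let d_gt0 (y : R) : 0 < y < 1 -> 0 < 1 - `|2 * y - 1|.
Proof.
move=> /andP[y0 y1]; rewrite subr_gt0 ltr_norml; apply/andP; split; lra.
Qed.

Let tK (y : R) : 0 < y < 1 -> s (t y) = y.
Proof.
move=> /d_gt0 h; rewrite /s /t.
set w := 2 * y - 1 in h *.
rewrite normrM normfV (gtr0_norm h).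
have -> : y = (1 + w) / 2 by rewrite /w; field.
field; lra.
Qed.

Let s_cont : continuous s.
Proof.
move=> u; have h : 0 < 1 + `|u| by rewrite ltr_wpDr.
apply: cvgMr_tmp; apply: cvgD; first exact: cvg_cst.
apply: cvgM => //; apply: cvgV; first lra.
by apply: cvgD; [exact: cvg_cst | exact: cvg_norm].
Qed.

Let t_cont (y : R) : 0 < y < 1 -> {for y, continuous t}.
Proof.
move=> /d_gt0 h.
have c : (fun y : R => 2 * y - 1) @ y --> 2 * y - 1.
  by apply: cvgB; [apply: cvgMl_tmp | exact: cvg_cst].
apply: cvgM => //; apply: cvgV; first lra.
by apply: cvgB; [exact: cvg_cst | exact: cvg_norm].
Qed.

Let s_incr : {homo s : x y / x < y}.
Proof.
move=> x y xy; rewrite /s ltr_pM2r ?invr_gt0 ?ltr0n// ltrD2l.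
have hx : 0 < 1 + `|x| by rewrite ltr_wpDr.
have hy : 0 < 1 + `|y| by rewrite ltr_wpDr.
rewrite ltr_pdivrMr// mulrAC ltr_pdivlMr//.
case: (ler0P x) => x0; case: (ler0P y) => y0; nra.
Qed.

Lemma unit_oo_identification : exists phi, Homeo_plus R (unit_oo R) phi.
Proof.
exists psi; split.
- by move=> x y xy; rewrite -lt_val /=; exact: s_incr.
- apply: (@continuous_comp_initial (unit_oo R) R R val psi); exact: s_cont.
- exists (t \o val); split=> [u|y|y] /=.
  + exact: sK.
  + apply: val_inj => /=; apply: tK.
    by have := valP y; rewrite inE /= in_itv.
  + apply: continuous_comp; first exact: initial_continuous.
    by apply: t_cont; have := valP y; rewrite inE /= in_itv.
Qed.

End identification.

(* Main.v *)
(* Every nontrivial element has finitely many fixed points, so comparing graphs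
   near +oo (or, reversed, near -oo) bi-orders the group.  Write [v >> d] when
   all powers of [d] lie below [v].  Two graphs cannot cross four times, and
   since the powers of an element converge to a step function this restricts
   which elements can dominate which.

   If some elements expand at both ends, those dominated by them at both ends
   form a nontrivial normal subgroup Z, because a commutator [~ v, w] of
   expanding elements is infinitesimal with respect to [v * w].  Either Z
   contains expanding elements, which must then have a single fixed point, and
   the elements of Z dominated by these act freely; or Z contains none.  In a
   normal subgroup without expanding elements both ends induce the same order,
   all positive elements with a fixed point are Archimedean equivalent (compare
   both of them with a conjugate translated far to the right), and the elements
   infinitesimal with respect to these act freely.  So some nontrivial normal
   subgroup always acts freely.  By Hoelder's argument its translation numbers
   define a monotone surjection of the line, which conjugation by the group
   changes by affine maps. *)
Require Import Defs.
From HB Require Import structures.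
From mathcomp Require Import all_boot all_order all_algebra.
From mathcomp Require Import all_classical all_reals all_analysis.
From mathcomp Require Import ring lra zify.

Set Implicit Arguments.
Unset Strict Implicit.
Unset Printing Implicit Defensive.

Import Order.TTheory GRing.Theory Num.Theory.
Import numFieldNormedType.Exports.

Local Open Scope classical_set_scope.
Local Open Scope ring_scope.

(** * Bi-ordered groups *)

Record biorder (T : groupType) := Biorder {
  blt :> T -> T -> Prop;
  blt_irr : forall x, ~ blt x x;
  blt_trans : forall y x z, blt x y -> blt y z -> blt x z;
  blt_total : forall x y, [\/ x = y, blt x y | blt y x];
  blt_mull : forall z x y, blt x y -> blt (z * x)%g (z * y)%g;
  blt_mulr : forall z x y, blt x y -> blt (x * z)%g (y * z)%g }.

Section Biorder.
Local Open Scope group_scope.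
Variables (T : groupType) (o : biorder T).
Implicit Types x y z f g v : T.

Definition ble x y := ~ o y x.

Lemma bleNlt x y : ble x y \/ o y x.
Proof. by rewrite /ble; case: (EM (o y x)); [right|left]. Qed.

Lemma ble_eqlt x y : ble x y -> x = y \/ o x y.
Proof. by case: (blt_total o x y) => [->|h|h //]; [left|right]. Qed.

Lemma blt_le x y : o x y -> ble x y.
Proof. by move=> xy yx; apply: (blt_irr (blt_trans xy yx)). Qed.

Lemma ble_refl x : ble x x. Proof. exact: blt_irr. Qed.
Local Hint Resolve ble_refl : core.

Lemma blt_le_trans y x z : o x y -> ble y z -> o x z.
Proof. by move=> xy /ble_eqlt[<- //|]; exact: blt_trans. Qed.

Lemma ble_lt_trans y x z : ble x y -> o y z -> o x z.
Proof. by move=> /ble_eqlt[<- //|]; exact: blt_trans. Qed.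

Lemma ble_trans y x z : ble x y -> ble y z -> ble x z.
Proof. by move=> /ble_eqlt[<- //|h1] h2; apply/blt_le/(blt_le_trans h1). Qed.

Lemma ble_anti x y : ble x y -> ble y x -> x = y.
Proof. by move=> /ble_eqlt[//|h]. Qed.

Lemma ble_mul x x' y y' : ble x x' -> ble y y' -> ble (x * y) (x' * y').
Proof.
move=> h1 h2; apply: (@ble_trans (x' * y)).
- by case: (ble_eqlt h1) => [<- //|h]; apply/blt_le/blt_mulr.
- by case: (ble_eqlt h2) => [<- //|h]; apply/blt_le/blt_mull.
Qed.

Lemma blt_le_mul x x' y y' : o x x' -> ble y y' -> o (x * y) (x' * y').
Proof.
by move=> h1 h2; apply: (blt_le_trans (blt_mulr y h1)); apply: ble_mul.
Qed.

Lemma ble_exp n x y : ble x y -> ble (x ^+ n) (y ^+ n).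
Proof. by move=> h; elim: n => // n; rewrite !expgS; exact: ble_mul. Qed.

Lemma bltV x y : o x y -> o y^-1 x^-1.
Proof.
by move=> /(blt_mulr x^-1) /(blt_mull y^-1); rewrite mulgV mulg1 mulKg.
Qed.

Lemma bleV x y : ble x y -> ble y^-1 x^-1.
Proof. by move=> /ble_eqlt[-> //|/bltV/blt_le]. Qed.

Lemma ble1_exp n x : ble 1 x -> ble 1 (x ^+ n).
Proof. by move=> h; rewrite -(expg1n T n); exact: ble_exp. Qed.

Lemma bltJ x y z : o x y -> o (x ^ z) (y ^ z).
Proof. by move=> h; rewrite !conjgE; apply/blt_mull/blt_mulr. Qed.

(* Replacing one factor [f * g] by [g * f] at a time only increases the product,
   so no commutation is needed. *)
Lemma expgM_le n f g : ble (f * g) (g * f) -> ble (f ^+ n * g ^+ n) ((f * g) ^+ n).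
Proof.
move=> fg; elim: n => [|n IH]; first by rewrite mulg1.
rewrite expgS [g ^+ n.+1]expgSr -mulgA [_ ^+ n * (_ * _)]mulgA.
apply: (@ble_trans (f * ((f * g) ^+ n * g))).
  by apply: ble_mul => //; apply: ble_mul.
have -> : (f * g) ^+ n.+1 = f * ((g * f) ^+ n * g).
  rewrite expgSr !mulgA; congr (_ * _); elim: n {IH} => [|n IHn].
    by rewrite mul1g mulg1.
  by rewrite expgS -mulgA IHn expgS !mulgA.
by apply: ble_mul => //; apply: ble_mul => //; apply: ble_exp.
Qed.

Lemma expgM_le' n f g : ble (g * f) (f * g) -> ble (g ^+ n * f ^+ n) ((f * g) ^+ n).
Proof.
by move=> fg; apply: (ble_trans (expgM_le fg)); apply: ble_exp.
Qed.

Definition zexp v (z : int) := match z with Posz n => v ^+ n | Negz n => v ^- n.+1 end.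

Lemma zexpS v (z : int) : zexp v (z + 1)%R = zexp v z * v.
Proof.
case: z => n; first by rewrite -PoszD addn1 /= expgSr.
case: n => [|n]; first by rewrite /= expg1 mulVg.
have -> : (Negz n.+1 + 1)%R = Negz n by rewrite !NegzE; lia.
by rewrite /= [v ^+ n.+2]expgS invgM -mulgA mulVg mulg1.
Qed.

Lemma zexpP v (z : int) : zexp v (z - 1)%R = zexp v z * v^-1.
Proof. by rewrite -[z in RHS](subrK 1%R) zexpS mulgK. Qed.

Lemma zexpD v (m n : int) : zexp v (m + n)%R = zexp v m * zexp v n.
Proof.
elim/int_ind: n => [|n IH|n IH]; first by rewrite addr0 mulg1.
- by rewrite -addn1 PoszD addrA !zexpS IH mulgA.
- by rewrite -addn1 PoszD opprD addrA !zexpP IH mulgA.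
Qed.

Lemma zexpN v (z : int) : zexp v (- z)%R = (zexp v z)^-1.
Proof. by apply/esym/mulg1_eq; rewrite -zexpD subrr. Qed.

Lemma zexpMn v (z : int) n : zexp v (z * n%:Z)%R = zexp v z ^+ n.
Proof.
elim: n => [|n IH]; first by rewrite mulr0.
by rewrite -addn1 PoszD mulrDr mulr1 zexpD IH addn1 expgSr.
Qed.

Lemma zexp_lt v (m n : int) : o 1 v -> (m < n)%R -> o (zexp v m) (zexp v n).
Proof.
move=> v1 mn; have -> : n = (m + 1 + (absz (n - m - 1)%R)%:Z)%R by lia.
move: (absz _) => k; rewrite zexpD zexpS -[X in o X _]mulg1 -[X in o (X * _) _]mulg1.
apply: blt_le_mul; first exact: blt_mull.
by apply: ble1_exp; apply: blt_le.
Qed.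

Lemma zexp_le_inv v (m n : int) : o 1 v -> ble (zexp v m) (zexp v n) -> (m <= n)%R.
Proof. by move=> v1 h; rewrite leNgt; apply/negP => /(zexp_lt v1). Qed.

End Biorder.

(** * Translation numbers *)

Lemma exists_invn_lt (R : realType) (e : R) : 0 < e ->
  exists2 q : nat, (0 < q)%N & q%:R^-1 < e.
Proof.
move=> e0; exists (Num.truncn e^-1).+1 => //.
by rewrite -[ltRHS]invrK ltf_pV2 ?posrE ?invr_gt0 ?ltr0n// truncnS_gt.
Qed.

Section TranslationNumber.
Local Open Scope group_scope.
Variables (R : realType) (T : groupType) (o : biorder T) (v : T).
Hypothesis v1 : o 1 v.
Implicit Types f g d : T.

(** Not symmetric in [v] and [f]: [f] may be infinitesimal relative to [v]. The bounds only make the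
    translation number finite. *)
Definition commensurable f :=
  exists n : nat, ble o (zexp v (- n%:Z)%R) f /\ ble o f (zexp v n%:Z).

Definition infinitesimal d := forall n, o (d ^+ n) v /\ o (d ^- n) v.

Definition tau_set f : set R := [set r | exists z : int, exists2 q : nat,
  (0 < q)%N & r = (z%:~R / q%:R)%R /\ ble o (zexp v z) (f ^+ q)].

(** Hoelder's translation number: the size of [f] in units of [v], as the supremum of a lower cut of
    rationals. *)
Definition tau f := sup (tau_set f).

Lemma commensurableM f g : commensurable f -> commensurable g -> commensurable (f * g).
Proof.
move=> [m [m1 m2]] [n [n1 n2]]; exists (m + n)%N.
by rewrite PoszD opprD !zexpD; split; apply: ble_mul.
Qed.

Lemma commensurableV f : commensurable f -> commensurable f^-1.
Proof.
move=> [m [m1 m2]]; exists m; split; first by rewrite zexpN; apply: bleV.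
by rewrite -[m%:Z]opprK zexpN; apply: bleV.
Qed.

Lemma commensurable1 : commensurable 1.
Proof. by exists 0%N; rewrite oppr0; split; exact: ble_refl. Qed.

Lemma commensurableX n f : commensurable f -> commensurable (f ^+ n).
Proof.
move=> hf; elim: n => [|n IH]; first exact: commensurable1.
by rewrite expgS; apply: commensurableM.
Qed.

Lemma commensurable_self : commensurable v.
Proof.
exists 1%N; rewrite zexpN /= expg1; split; last exact: ble_refl.
apply: (@ble_trans _ _ 1); last exact: blt_le.
by rewrite -[1]invg1; apply/bleV/blt_le.
Qed.

Lemma commensurable_between f : ble o v^-1 f -> ble o f v -> commensurable f.
Proof. by move=> h1 h2; exists 1%N; rewrite zexpN /= expg1. Qed.

Let ratio_le (z z' : int) (q q' : nat) : (0 < q)%N -> (0 < q')%N ->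
  (z * q'%:Z <= z' * q%:Z)%R -> (z%:~R / q%:R <= z'%:~R / q'%:R :> R)%R.
Proof.
move=> q0 q'0 h; rewrite ler_pdivrMr ?ltr0n// mulrAC ler_pdivlMr ?ltr0n//.
by rewrite !pmulrn -!intrM ler_int.
Qed.

(** Two fractions are compared through the common power [f ^+ (q * q')], which lies between two
    powers of [v]. *)
Let tau_set_le f r (z : int) q : (0 < q)%N -> ble o (f ^+ q) (zexp v z) ->
  tau_set f r -> (r <= z%:~R / q%:R)%R.
Proof.
move=> q0 h [z' [q' q'0 [-> h']]]; apply: ratio_le => //.
apply: (zexp_le_inv v1); rewrite !zexpMn.
apply: (@ble_trans _ _ (f ^+ (q * q'))).
  by rewrite mulnC expgnA; apply: ble_exp.
by rewrite expgnA; apply: ble_exp.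
Qed.

Let tau_has_sup f : commensurable f -> has_sup (tau_set f).
Proof.
move=> [n [n1 n2]]; split.
  by exists ((- n%:Z)%:~R / 1%:R)%R, (- n%:Z)%R, 1%N.
by exists (n%:Z%:~R / 1%:R)%R => r; apply: tau_set_le.
Qed.

Lemma tau_ge f (z : int) q : commensurable f -> (0 < q)%N ->
  ble o (zexp v z) (f ^+ q) -> (z%:~R / q%:R <= tau f)%R.
Proof.
by move=> hf q0 h; apply: ub_le_sup; [case: (tau_has_sup hf)|exists z, q].
Qed.

Lemma tau_le f (z : int) q : commensurable f -> (0 < q)%N ->
  ble o (f ^+ q) (zexp v z) -> (tau f <= z%:~R / q%:R)%R.
Proof.
move=> hf q0 h; apply: ge_sup; first by case: (tau_has_sup hf).
by move=> r; apply: tau_set_le.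
Qed.

Lemma tau_le_ub f (r : R) : commensurable f ->
  (forall (z : int) q, (0 < q)%N -> ble o (zexp v z) (f ^+ q) -> z%:~R / q%:R <= r)%R ->
  (tau f <= r)%R.
Proof.
move=> hf h; apply: ge_sup; first by case: (tau_has_sup hf).
by move=> _ [z [q q0 [-> /(h _ _ q0)]]].
Qed.

(* Whichever of [f * g], [g * f] is smaller, one of [f ^+ n * g ^+ n],
   [g ^+ n * f ^+ n] lies below [(f * g) ^+ n]: additivity holds although [f]
   and [g] need not commute. *)
Let tauM_ge f g : commensurable f -> commensurable g ->
  (tau f + tau g <= tau (f * g))%R.
Proof.
move=> hf hg; have hfg := commensurableM hf hg.
rewrite -lerBrDr; apply: tau_le_ub => // z q q0 hz.
rewrite lerBrDr addrC -lerBrDr; apply: tau_le_ub => // z' q' q'0 hz'.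
rewrite lerBrDr.
have -> : (z'%:~R / q'%:R + z%:~R / q%:R =
    (z * q'%:Z + z' * q%:Z)%:~R / (q * q')%:R :> R)%R.
  rewrite intrD !intrM natrM -!pmulrn; field.
  by rewrite !pnatr_eq0 -!lt0n q0 q'0.
apply: tau_ge => //; first by rewrite muln_gt0 q0.
have Hf : ble o (zexp v (z * q'%:Z)%R) (f ^+ (q * q')).
  by rewrite zexpMn expgnA; apply: ble_exp.
have Hg : ble o (zexp v (z' * q%:Z)%R) (g ^+ (q * q')).
  by rewrite zexpMn mulnC expgnA; apply: ble_exp.
case: (bleNlt o (f * g) (g * f)) => [c|/blt_le c].
  by apply: ble_trans (expgM_le c); rewrite zexpD; apply: ble_mul.
by apply: ble_trans (expgM_le' c); rewrite addrC zexpD; apply: ble_mul.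
Qed.

Lemma tau1 : tau 1 = 0%R.
Proof.
apply/eqP; rewrite eq_le; apply/andP; split.
  have := @tau_le 1 0 1%N commensurable1 isT; rewrite mul0r; apply; exact: ble_refl.
have := @tau_ge 1 0 1%N commensurable1 isT; rewrite mul0r; apply; exact: ble_refl.
Qed.

(** Superadditivity on [f * f^-1] gives one inequality. For the other, take [z / q] above [tau f] by
    at most [1 / q]: then [f ^+ q] is not above the power [z] of [v], and inverting bounds
    [tau f^-1] below by [- z / q]. *)
Lemma tauV f : commensurable f -> tau f^-1 = (- tau f)%R.
Proof.
move=> hf; have hV := commensurableV hf.
apply/eqP; rewrite eq_le; apply/andP; split.
  by have := tauM_ge hf hV; rewrite mulgV tau1; lra.
rewrite lerNl; apply/ler_addgt0Pr => e e0.
have [q q0 hq] := exists_invn_lt e0.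
pose z := (Num.floor (tau f * q%:R) + 1)%R.
have hz : (tau f < z%:~R / q%:R)%R.
  by rewrite ltr_pdivlMr ?ltr0n// floorD1_gt.
have hz2 : (z%:~R / q%:R <= tau f + q%:R^-1)%R.
  rewrite ler_pdivrMr ?ltr0n// mulrDl mulVf ?pnatr_eq0 -?lt0n// intrD lerD2r.
  exact: floor_le.
have : ((- z)%:~R / q%:R <= tau f^-1)%R.
  apply: tau_ge => //; rewrite zexpN expVgn; apply: bleV => lt.
  by have := tau_ge hf q0 (blt_le lt); rewrite leNgt hz.
rewrite rmorphN/= mulNr; lra.
Qed.

(** The upper bound is superadditivity applied to the factors [f * g] and [g^-1]. *)
Lemma tauM f g : commensurable f -> commensurable g ->
  tau (f * g) = (tau f + tau g)%R.
Proof.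
move=> hf hg; apply/eqP; rewrite eq_le tauM_ge// andbT.
have := tauM_ge (commensurableM hf hg) (commensurableV hg).
by rewrite mulgK tauV//; lra.
Qed.

Lemma tauX n f : commensurable f -> tau (f ^+ n) = (n%:R * tau f)%R.
Proof.
move=> hf; elim: n => [|n IH]; first by rewrite mul0r tau1.
by rewrite expgS tauM ?IH -?natr1 1?mulrDl ?mul1r 1?addrC//; apply: commensurableX.
Qed.

Lemma tau_self : tau v = 1%R.
Proof.
have h := commensurable_self; apply/eqP; rewrite eq_le; apply/andP; split.
  by rewrite -(divr1 1%R); apply: (@tau_le v 1 1%N) => //; exact: ble_refl.
by rewrite -[leLHS](divr1 1%R); apply: (@tau_ge v 1 1%N) => //; exact: ble_refl.
Qed.

Lemma tau_mono f g : commensurable f -> commensurable g -> ble o f g ->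
  (tau f <= tau g)%R.
Proof.
move=> hf hg fg; apply: tau_le_ub => // z q q0 h; apply: tau_ge => //.
by apply: (ble_trans h); apply: ble_exp.
Qed.

(** Infinitesimals form the kernel of the homomorphism [tau], hence are closed under products
    without any commutation. *)
Lemma infinitesimalP d : infinitesimal d <-> commensurable d /\ tau d = 0%R.
Proof.
split=> [h|[hd t0] n].
  have hd : commensurable d.
    apply: commensurable_between; last by have [/blt_le] := h 1%N.
    by have [_ /blt_le/bleV] := h 1%N; rewrite invgK.
  split=> //; apply/eqP; rewrite eq_le; apply/andP; split.
  - rewrite leNgt; apply/negP => /exists_invn_lt[n n0 hn].
    have := @tau_le d 1 n hd n0 (blt_le (proj1 (h n))).
    by rewrite leNgt mul1r hn.
  - rewrite leNgt; apply/negP; rewrite -oppr_gt0 => /exists_invn_lt[n n0 hn].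
    have := @tau_le d^-1 1 n (commensurableV hd) n0.
    rewrite expVgn tauV// => /(_ (blt_le (proj2 (h n)))).
    by rewrite leNgt mul1r hn.
have key e : commensurable e -> tau e = 0%R -> o e v.
  move=> he te; case: (bleNlt o v e) => // ve.
  by have := tau_mono commensurable_self he ve; rewrite te tau_self ler10.
split; apply: key.
- exact: commensurableX.
- by rewrite tauX// t0 mulr0.
- exact/commensurableV/commensurableX.
- by rewrite tauV ?tauX// ?t0 ?mulr0 ?oppr0//; apply: commensurableX.
Qed.

Lemma infinitesimalM d d' : infinitesimal d -> infinitesimal d' -> infinitesimal (d * d').
Proof.
move=> /infinitesimalP[h t] /infinitesimalP[h' t']; apply/infinitesimalP; split.
  exact: commensurableM.
by rewrite tauM// t t' addr0.
Qed.

(** [tau] takes values in an abelian group, so it kills commutators. *)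
Lemma infinitesimalR f g : commensurable f -> commensurable g -> infinitesimal [~ f, g].
Proof.
move=> hf hg; have hfV := commensurableV hf; have hgV := commensurableV hg.
rewrite commgEl conjgE; apply/infinitesimalP; split.
  by do !apply: commensurableM.
by rewrite !tauM ?tauV//; [lra|do ?apply: commensurableM..].
Qed.

End TranslationNumber.

Section Infinitesimal.
Local Open Scope group_scope.
Variables (T : groupType) (o : biorder T).
Implicit Types v d g : T.

Lemma infinitesimal1 v : o 1 v -> infinitesimal o v 1.
Proof. by move=> h n; rewrite expg1n invg1. Qed.

Lemma infinitesimalV v d : infinitesimal o v d -> infinitesimal o v d^-1.
Proof. by move=> h n; rewrite expVgn invgK; have [] := h n. Qed.

Lemma infinitesimalX v d m : infinitesimal o v d -> infinitesimal o v (d ^+ m).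
Proof. by move=> h n; rewrite -expgnA; apply: h. Qed.

Lemma infinitesimalJ g v d : infinitesimal o v d -> infinitesimal o (v ^ g) (d ^ g).
Proof.
by move=> h n; rewrite -conjXg -conjVg; have [h1 h2] := h n; split; apply: bltJ.
Qed.

Lemma infinitesimal_le v w d : ble o v w -> infinitesimal o v d -> infinitesimal o w d.
Proof. by move=> vw h n; have [h1 h2] := h n; split; apply: blt_le_trans vw. Qed.

End Infinitesimal.

(** * Actions on the line *)

(** The group law makes each [act g] bijective. Listing four increasing fixed points avoids
    cardinalities. *)
Record line_action (R : realType) (T : groupType) := LineAction {
  act :> T -> R -> R;
  act1 : forall x, act 1%g x = x;
  actM : forall g h x, act (g * h)%g x = act g (act h x);
  act_lt : forall g x y, x < y -> act g x < act g y;
  act_fix4 : forall g x1 x2 x3 x4, x1 < x2 -> x2 < x3 -> x3 < x4 ->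
    act g x1 = x1 -> act g x2 = x2 -> act g x3 = x3 -> act g x4 = x4 ->
    g = 1%g }.

Section LineAction.
Variables (R : realType) (T : groupType) (A : line_action R T).
Implicit Types (f g h k : T) (s x y z : R).

Lemma actK g : cancel (A g) (A g^-1%g).
Proof. by move=> x; rewrite -actM mulVg act1. Qed.

Lemma actVK g : cancel (A g^-1%g) (A g).
Proof. by move=> x; rewrite -actM mulgV act1. Qed.

Lemma act_ltE g x y : (A g x < A g y) = (x < y).
Proof.
case: (ltgtP x y) => [/(act_lt A g) -> //|/(act_lt A g) /lt_gtF //|->].
by rewrite ltxx.
Qed.

Lemma act_leE g x y : (A g x <= A g y) = (x <= y).
Proof. by rewrite !leNgt act_ltE. Qed.

Lemma actV_lt g x y : (A g^-1%g x < y) = (x < A g y).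
Proof. by rewrite -(act_ltE g) actVK. Qed.

Lemma actV_gt g x y : (x < A g^-1%g y) = (A g x < y).
Proof. by rewrite -(act_ltE g) actVK. Qed.

Lemma actV_fix g s : A g s = s -> A g^-1%g s = s.
Proof. by move=> e; rewrite -[in LHS]e actK. Qed.

Lemma actX_fix g n s : A g s = s -> A (g ^+ n)%g s = s.
Proof.
by move=> e; elim: n => [|n IH]; rewrite ?act1// expgS actM IH.
Qed.

Lemma actXV_fix g n s : A g s = s -> A (g ^- n)%g s = s.
Proof. by move=> e; apply/actV_fix/actX_fix. Qed.

Lemma actJ g k x : A (g ^ k)%g x = A k^-1%g (A g (A k x)).
Proof. by rewrite conjgE !actM. Qed.

Lemma actJV g k x : A (g ^ k^-1)%g x = A k (A g (A k^-1%g x)).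
Proof. by rewrite actJ invgK. Qed.

Lemma actJV_fix g k s : A g s = s -> A (g ^ k^-1)%g (A k s) = A k s.
Proof. by move=> e; rewrite actJV actK e. Qed.

(* Knaster-Tarski: monotonicity suffices, so an action needs no continuity. *)
Lemma act_fixed_between g x y : x < y -> (x < A g x /\ A g y < y) ->
  exists2 z, x < z < y & A g z = z.
Proof.
move=> xy [gx gy]; pose S := [set t | [/\ x <= t, t <= y & t <= A g t]].
have Sx : S x by split=> //; exact: ltW.
have Sub : ubound S y by move=> t [].
have S0 : S !=set0 by exists x.
have bS : has_ubound S by exists y.
have xs : x <= sup S by exact: ub_le_sup.
have sy : sup S <= y by exact: ge_sup.
have h1 : sup S <= A g (sup S).
  apply: ge_sup => // t St; apply: (@le_trans _ _ (A g t)); first by case: St.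
  by rewrite act_leE; exact: ub_le_sup.
have h2 : A g (sup S) <= sup S.
  apply: ub_le_sup => //.
  split; [exact: le_trans h1| |by rewrite act_leE].
  by apply: le_trans (ltW gy); rewrite act_leE.
have e : A g (sup S) = sup S by apply/eqP; rewrite eq_le h1 h2.
exists (sup S) => //; rewrite !lt_neqAle xs sy !andbT; apply/andP; split.
  by apply: contraTN gx => /eqP ->; rewrite e ltxx.
by apply: contraTN gy => /eqP <-; rewrite e ltxx.
Qed.

Lemma act_coincide f g x y : x < y -> A f x < A g x -> A g y < A f y ->
  exists2 z, x < z < y & A (f^-1 * g)%g z = z.
Proof.
move=> xy h1 h2; apply: act_fixed_between => //.
by rewrite !actM actV_lt actV_gt.
Qed.

Lemma act_coincide' f g x y : x < y -> A g x < A f x -> A f y < A g y ->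
  exists2 z, x < z < y & A (f^-1 * g)%g z = z.
Proof.
move=> xy h1 h2; have [z hz ez] := act_coincide xy h1 h2.
by exists z => //; move/actV_fix: ez; rewrite invgM invgK.
Qed.

(** Each change of sides gives a fixed point of [f^-1 * g] or of its inverse; four of them force
    [f = g]. *)
Lemma act_alternate5 f g x0 x1 x2 x3 x4 :
  x0 < x1 -> x1 < x2 -> x2 < x3 -> x3 < x4 ->
  A f x0 < A g x0 -> A g x1 < A f x1 -> A f x2 < A g x2 -> A g x3 < A f x3 ->
  A f x4 < A g x4 -> False.
Proof.
move=> x01 x12 x23 x34 h0 h1 h2 h3 h4.
have [z1 /andP[_ z1x] e1] := act_coincide x01 h0 h1.
have [z2 /andP[xz2 z2x] e2] := act_coincide' x12 h1 h2.
have [z3 /andP[xz3 z3x] e3] := act_coincide x23 h2 h3.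
have [z4 /andP[xz4 _] e4] := act_coincide' x34 h3 h4.
have := act_fix4 (lt_trans z1x xz2) (lt_trans z2x xz3) (lt_trans z3x xz4) e1 e2 e3 e4.
by move=> /mulg1_eq; rewrite invgK => e; move: h0; rewrite e ltxx.
Qed.

(** If the orbit stayed below [y], its supremum would be moved to the right by [g]; then an orbit
    point lies beyond the preimage of the supremum, and its image beyond the supremum itself. *)
Lemma act_escape g x y : x < A g x ->
  (forall t, x <= t -> t <= y -> t < A g t) ->
  exists N, forall n, (N <= n)%N -> y < A (g ^+ n)%g x.
Proof.
move=> gx h.
have mono m n : (m <= n)%N -> A (g ^+ m)%g x <= A (g ^+ n)%g x.
  move/subnK <-; elim: (n - m)%N => [//|k IH]; rewrite addSn.
  by apply: (le_trans IH); rewrite expgSr actM act_leE ltW.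
suff [N hN] : exists N, y < A (g ^+ N)%g x.
  by exists N => n /mono; apply: lt_le_trans.
apply: contrapT => /forallNP hN.
pose S := range (fun n => A (g ^+ n)%g x).
have Sx : S x by exists 0%N; rewrite ?act1.
have Sy : ubound S y by move=> _ [n _ <-]; rewrite leNgt; apply/negP.
have S0 : S !=set0 by exists x.
have xs : x <= sup S by apply: ub_le_sup => //; exists y.
have := h _ xs (ge_sup S0 Sy); rewrite -actV_lt => /(sup_gt S0)[_ [n _ <-]].
rewrite actV_lt -actM -expgS ltNge => /negP; apply.
by apply: ub_le_sup; [exists y|exists n.+1].
Qed.

Definition end_lt f g := exists M, forall x, M < x -> A f x < A g x.

Lemma act_last_fixed g s : g != 1%g -> A g s = s ->
  exists z, [/\ s <= z, A g z = z & forall x, z < x -> A g x <> x].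
Proof.
move=> g1 e1; apply: contrapT => /forallNP hN.
have next z : s <= z -> A g z = z -> exists2 x, z < x & A g x = x.
  move=> sz ez; apply: contrapT => hz; apply: (hN z); split=> // x zx ex.
  by apply: hz; exists x.
have [x2 h2 e2] := next _ (lexx s) e1.
have [x3 h3 e3] := next _ (ltW h2) e2.
have [x4 h4 e4] := next _ (ltW (lt_trans h2 h3)) e3.
by move: g1; rewrite (act_fix4 h2 h3 h4 e1 e2 e3 e4) eqxx.
Qed.

(** A change of sign would create a fixed point in between. *)
Lemma act_sign_right g z : (forall x, z < x -> A g x <> x) ->
  (forall x, z < x -> x < A g x) \/ (forall x, z < x -> A g x < x).
Proof.
move=> h.
have zS : z < z + 1 by rewrite ltrDl.
have sg x : z < x -> x < A g x \/ A g x < x.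
  by move=> /h/eqP; rewrite neq_lt => /orP[|]; [right|left].
have nocr x y : z < x -> z < y -> x < A g x -> A g y < y -> False.
  move=> zx zy h1 h2; case: (ltgtP x y) => [xy|yx|xy].
  - have [t /andP[xt _] et] := act_fixed_between xy (conj h1 h2).
    by apply: (h t) => //; exact: lt_trans xt.
  - have := @act_fixed_between g^-1%g _ _ yx; rewrite actV_lt actV_gt.
    move=> /(_ (conj h2 h1))[t /andP[yt _] /actV_fix]; rewrite invgK.
    by apply: h; exact: lt_trans yt.
  - by move: h2; rewrite -xy => /lt_trans /(_ h1); rewrite ltxx.
case: (sg _ zS) => hS; [left|right] => x zx.
- by case: (sg _ zx) => // hx; case: (nocr _ _ zS zx hS hx).
- by case: (sg _ zx) => // hx; case: (nocr _ _ zx zS hx hS).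
Qed.

Lemma act_sign_end g : g != 1%g -> exists z,
  (forall x, z < x -> x < A g x) \/ (forall x, z < x -> A g x < x).
Proof.
move=> g1; case: (EM (exists s, A g s = s)) => [[s]|/forallNP h].
  by move=> /(act_last_fixed g1)[z [_ _ /act_sign_right]]; exists z.
by exists 0; apply: act_sign_right => x _; exact: h.
Qed.

Lemma end_lt_irr f : ~ end_lt f f.
Proof. by move=> [M /(_ (M + 1))]; rewrite ltrDl ltr01 ltxx => /(_ isT). Qed.

Lemma end_lt_trans g f h : end_lt f g -> end_lt g h -> end_lt f h.
Proof.
move=> [M hM] [N hN]; exists (Num.max M N) => x; rewrite gt_max => /andP[Mx Nx].
exact: lt_trans (hM x Mx) (hN x Nx).
Qed.

Lemma end_lt_mull h f g : end_lt f g -> end_lt (h * f)%g (h * g)%g.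
Proof. by move=> [M hM]; exists M => x /hM; rewrite !actM act_ltE. Qed.

Lemma end_lt_mulr h f g : end_lt f g -> end_lt (f * h)%g (g * h)%g.
Proof.
by move=> [M hM]; exists (A h^-1%g M) => x; rewrite actV_lt !actM; exact: hM.
Qed.

Lemma end_lt_total f g : [\/ f = g, end_lt f g | end_lt g f].
Proof.
case: (eqVneq (f^-1 * g)%g 1%g) => [/mulg1_eq|].
  by rewrite invgK; constructor 1.
move=> /act_sign_end[z []] hz; [constructor 2|constructor 3]; exists z => x /hz.
- by rewrite actM actV_gt.
- by rewrite actM actV_lt.
Qed.

Definition end_order := Biorder end_lt_irr end_lt_trans end_lt_total
  end_lt_mull end_lt_mulr.

Lemma act_last_fixed_pos g s : end_order 1%g g -> A g s = s ->
  exists z, [/\ s <= z, A g z = z & forall x, z < x -> x < A g x].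
Proof.
move=> g1 es; have gN1 : g != 1%g.
  by apply: contra_notN (@end_lt_irr g) => /eqP e; rewrite {1}e.
have [z [sz ez /act_sign_right[h|h]]] := act_last_fixed gN1 es; exists z; split=> //.
case: g1 => M hM x zx; pose w := Num.max M z + 1.
have [Mw zw] : M < w /\ z < w.
  by split; apply: ltr_pwDr; rewrite // le_max lexx ?orbT.
by have := hM _ Mw; rewrite act1 => /(lt_trans (h _ zw)); rewrite ltxx.
Qed.

Lemma act_escape_right g z x y : (forall t, z < t -> t < A g t) -> z < x ->
  exists N, forall n, (N <= n)%N -> y < A (g ^+ n)%g x.
Proof.
move=> h zx; apply: act_escape => [|t xt _]; first exact: h.
by apply: h; exact: lt_le_trans xt.
Qed.

Lemma act_attract_right g z x y : (forall t, z < t -> t < A g t) -> z < y ->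
  exists N, forall n, (N <= n)%N -> A (g ^- n)%g x < y.
Proof.
by move=> h zy; have [N hN] := act_escape_right x h zy; exists N => n /hN; rewrite actV_lt.
Qed.

End LineAction.

(** * Reversing the line, to transfer results from +oo to -oo *)

Section Reflection.
Variables (R : realType) (T : groupType) (A : line_action R T).

Let refl1 x : - A 1%g (- x) = x. Proof. by rewrite act1 opprK. Qed.

Let reflM g h x : - A (g * h)%g (- x) = - A g (- - A h (- x)).
Proof. by rewrite actM opprK. Qed.

Let refl_lt g x y : x < y -> - A g (- x) < - A g (- y).
Proof. by move=> xy; rewrite ltrN2 act_ltE ltrN2. Qed.

Let refl_fix4 g x1 x2 x3 x4 : x1 < x2 -> x2 < x3 -> x3 < x4 ->
  - A g (- x1) = x1 -> - A g (- x2) = x2 -> - A g (- x3) = x3 ->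
  - A g (- x4) = x4 -> g = 1%g.
Proof.
rewrite -[x1 < x2]ltrN2 -[x2 < x3]ltrN2 -[x3 < x4]ltrN2 => h1 h2 h3 e1 e2 e3 e4.
have flip t : - A g (- t) = t -> A g (- t) = - t.
  by move=> e; rewrite -[LHS]opprK e.
exact: (act_fix4 h3 h2 h1 (flip _ e4) (flip _ e3) (flip _ e2) (flip _ e1)).
Qed.

Definition refl_action := LineAction refl1 reflM refl_lt refl_fix4.

End Reflection.

Section TwoEnds.
Variables (R : realType) (T : groupType) (A : line_action R T).
Implicit Types (f g h k : T) (s x y z : R).

Definition order_pos := end_order A.
(* Germs at -oo, ordered by [fun x => - g (- x)] at +oo: an element is positive
   for [order_neg] when it moves points near -oo to the left. *)
Definition order_neg := end_order (refl_action A).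

Lemma order_negE f g : order_neg f g <-> exists M, forall x, x < M -> A g x < A f x.
Proof.
split=> -[M hM]; exists (- M) => x.
  by rewrite ltrNr => /hM/=; rewrite opprK ltrN2.
by rewrite ltrNl => /hM/=; rewrite ltrN2.
Qed.

Lemma act_first_fixed g s : order_neg 1%g g -> A g s = s ->
  exists y, [/\ y <= s, A g y = y & forall x, x < y -> A g x < x].
Proof.
move=> g1 es; have e' : refl_action A g (- s) = - s by rewrite /= opprK es.
have [z [sz ez hz]] := act_last_fixed_pos g1 e'; exists (- z); split.
- by rewrite lerNl.
- by rewrite -[RHS]opprK -{2}ez /= opprK opprK.
- by move=> x; rewrite ltrNr => /hz /=; rewrite opprK ltrN2.
Qed.

Lemma act_escape_left g y x b : (forall t, t < y -> A g t < t) -> x < y ->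
  exists N, forall n, (N <= n)%N -> A (g ^+ n)%g x < b.
Proof.
move=> h xy.
have h' t : - y < t -> t < refl_action A g t by rewrite ltrNl /= ltrNr => /h.
have xy' : - y < - x by rewrite ltrN2.
have [N hN] := act_escape_right (- b) h' xy'.
by exists N => n /hN; rewrite /= opprK ltrN2.
Qed.

Lemma act_attract_left g y x b : (forall t, t < y -> A g t < t) -> b < y ->
  exists N, forall n, (N <= n)%N -> b < A (g ^- n)%g x.
Proof.
by move=> h zy; have [N hN] := act_escape_left x h zy; exists N => n /hN; rewrite actV_gt.
Qed.

End TwoEnds.

(** * Groups without expanding elements *)

Record normal_subgroup (T : groupType) (D : T -> Prop) := NormalSubgroup {
  ns1 : D 1%g;
  nsM : forall f g, D f -> D g -> D (f * g)%g;
  nsV : forall f, D f -> D f^-1%g;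
  nsJ : forall f g, D f -> D (f ^ g)%g }.

Lemma nsX (T : groupType) (D : T -> Prop) (hD : normal_subgroup D) f n :
  D f -> D (f ^+ n)%g.
Proof.
move=> h; elim: n => [|n IH]; first exact: (ns1 hD).
by rewrite expgS; apply: (nsM hD).
Qed.

Lemma nsR (T : groupType) (D : T -> Prop) (hD : normal_subgroup D) f g :
  D f -> D [~ f, g]%g.
Proof. by move=> h; rewrite commgEl; apply: (nsM hD); [apply: (nsV hD)|apply: (nsJ hD)]. Qed.

Section Core.
Variables (R : realType) (T : groupType) (A : line_action R T).
Hypothesis dense : forall x a b, a < b -> exists g, a < A g x < b.
Implicit Types (f g h k c d e : T) (s x y z : R) (D Z : T -> Prop).

Definition free D := forall d s, D d -> A d s = s -> d = 1%g.

Definition has_free_normal := exists D,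
  [/\ normal_subgroup D, (exists2 d, D d & d != 1%g) & free D].

Lemma act_beyond x M : exists k, M < A k x.
Proof. by have [|k /andP[]] := @dense x M (M + 1); [rewrite ltrDl|exists k]. Qed.

(** [c] preserves the fixed points of [e]; if it moved [s], the points [s], [c s], [c^2 s], [c^3 s]
    would be four of them. *)
Lemma commute_fix e c s : commute e c -> A e s = s -> e != 1%g -> A c s = s.
Proof.
move=> ec es /eqP e1.
have fx n : A e (A (c ^+ n)%g s) = A (c ^+ n)%g s.
  by rewrite -actM (commuteX n ec) actM es.
case: (ltgtP (A c s) s) => // h; case: e1.
- have lt n : A (c ^+ n.+1)%g s < A (c ^+ n)%g s by rewrite expgSr actM act_ltE.
  exact: (act_fix4 (lt 2%N) (lt 1%N) (lt 0%N) (fx _) (fx _) (fx _) (fx _)).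
- have lt n : A (c ^+ n)%g s < A (c ^+ n.+1)%g s by rewrite expgSr actM act_ltE.
  exact: (act_fix4 (lt 0%N) (lt 1%N) (lt 2%N) (fx _) (fx _) (fx _) (fx _)).
Qed.

Lemma actX_gt g x n : x < A g x -> x < A (g ^+ n.+1)%g x.
Proof.
move=> h; elim: n => // n IH.
by rewrite expgS actM; apply: (lt_trans h); rewrite act_ltE.
Qed.

Section NotExpanding.
Variable Z : T -> Prop.
Hypothesis nZ : normal_subgroup Z.
Hypothesis Zends : forall d, Z d -> ~ (order_pos A 1%g d /\ order_neg A 1%g d).

(** Otherwise [f^-1 * g] would be positive at both ends. As [order_neg] reverses the line, this says
    that the graph of [f] lies below that of [g] near -oo as well. *)
Let Zopp f g : Z f -> Z g -> order_pos A f g -> order_neg A g f.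
Proof.
move=> Zf Zg fg.
have h : order_pos A 1%g (f^-1 * g)%g.
  by have := blt_mull f^-1%g fg; rewrite mulVg.
case: (blt_total (order_neg A) f g) => // [e|h2].
  by move: fg; rewrite e => /blt_irr.
case: (Zends (nsM nZ (nsV nZ Zf) Zg)); split=> //.
by have := blt_mull f^-1%g h2; rewrite mulVg.
Qed.

Let Zfirst d s : Z d -> order_pos A 1%g d -> A d s = s ->
  exists y, [/\ y <= s, A d y = y & forall x, x < y -> x < A d x].
Proof.
move=> Zd d1 ds.
have := Zopp (ns1 nZ) Zd d1 => /bltV; rewrite invg1 => dV.
have [y [ys ey hy]] := act_first_fixed dV (actV_fix ds).
exists y; split=> //; first by rewrite -[in LHS]ey actVK.
by move=> x /hy; rewrite actV_lt.
Qed.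

(** A high power of [d] would cross [e] four times: it is below [e] near both ends and at its fixed
    point [y], but above [e] at a point left of [y] and at the fixed point [z] of [e]. *)
Let left_not_infinitesimal d e y z : Z d -> Z e ->
  A d y = y -> (forall t, t < y -> t < A d t) ->
  (forall t, t <= y -> t < A e t) -> y < z -> A e z = z -> z < A d z ->
  ~ infinitesimal (order_pos A) e d.
Proof.
move=> Zd Ze dy dl el yz ez dz inf.
pose x := A e^-1%g y - 1.
have xVy : x < A e^-1%g y by rewrite /x ltrBlDr ltrDl.
have Vyy : A e^-1%g y < y by rewrite actV_lt el.
have xy := lt_trans xVy Vyy.
have exy : A e x < y by rewrite -actV_gt.
have [||N hN] := @act_escape _ _ A d x (A e x); first exact: dl.
  by move=> t xt te; apply: dl; apply: le_lt_trans exy.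
have hx := hN _ (leqnSn N).
have [lt1 _] := inf N.+1.
have [M hM] := (order_negE _ _ _).1 (Zopp (nsX nZ N.+1 Zd) Ze lt1).
have [M' hM'] := lt1.
have [x0M x0x] : Num.min M x - 1 < M /\ Num.min M x - 1 < x.
  by split; rewrite ltrBlDr ltr_pwDr// ge_min lexx ?orbT.
have [x4M x4z] : M' < Num.max M' z + 1 /\ z < Num.max M' z + 1.
  by split; apply: ltr_pwDr; rewrite // le_max lexx ?orbT.
apply: (act_alternate5 x0x xy yz x4z (hM _ x0M) hx _ _ (hM' _ x4M)).
- by rewrite actX_fix// el.
- by rewrite ez; exact: actX_gt.
Qed.

(** A high power of [e] would cross [c] four times: it is below [c] near both ends and at its fixed
    point [z], but above [c] at the fixed point [y] of [c] and at [z + 1]. *)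
Let right_not_infinitesimal c e y z : Z c -> Z e ->
  A c y = y -> y < A e y -> y < z -> A e z = z -> z < A c z ->
  (forall t, z < t -> t < A e t) ->
  ~ infinitesimal (order_pos A) c e.
Proof.
move=> Zc Ze cy ey yz ez cz er inf.
have zx : z < z + 1 by rewrite ltrDl.
have [N hN] := act_escape_right (A c (z + 1)) er zx.
have hx := hN _ (leqnSn N).
have [lt1 _] := inf N.+1.
have [M hM] := (order_negE _ _ _).1 (Zopp (nsX nZ N.+1 Ze) Zc lt1).
have [M' hM'] := lt1.
have [x0M x0y] : Num.min M y - 1 < M /\ Num.min M y - 1 < y.
  by split; rewrite ltrBlDr ltr_pwDr// ge_min lexx ?orbT.
have [x4M x4z] : M' < Num.max M' (z + 1) + 1 /\ z + 1 < Num.max M' (z + 1) + 1.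
  by split; apply: ltr_pwDr; rewrite // le_max lexx ?orbT.
apply: (act_alternate5 x0y yz zx x4z (hM _ x0M) _ _ hx (hM' _ x4M)).
- by rewrite cy; exact: actX_gt.
- by rewrite actX_fix.
Qed.

Let D d := Z d /\ exists c, [/\ Z c, order_pos A 1%g c, (exists s, A c s = s) &
  infinitesimal (order_pos A) c d].

(* If [c] dominates [d] and both have fixed points, a conjugate [e] of [c]
   translated to the right of all of these satisfies neither [d << e] nor
   [e << c], which contradicts [d << c]. *)
Lemma free_normal_not_expanding c s : Z c -> c != 1%g -> A c s = s -> has_free_normal.
Proof.
move=> Zc0 c01 c0s.
have {c c01 Zc0 c0s} [c [Zc c1 cs]] : exists c, [/\ Z c, order_pos A 1%g c & A c s = s].
  case: (blt_total (order_pos A) 1%g c) => [e|h|h]; first by rewrite -e eqxx in c01.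
    by exists c.
  exists c^-1%g; split; [exact: (nsV nZ)| |exact: actV_fix].
  by rewrite -invg1; apply: bltV.
have [z [sz cz hz]] := act_last_fixed_pos c1 cs.
have D1 : D 1%g.
  by split; [exact: (ns1 nZ)|exists c; split=> //; [exists s|exact: infinitesimal1]].
exists D; split.
- split=> //.
  + move=> f g [Zf [c1' [Z1 p1 [s1 e1] i1]]] [Zg [c2 [Z2 p2 [s2 e2] i2]]].
    split; first exact: (nsM nZ).
    case: (bleNlt (order_pos A) c1' c2) => [le|/blt_le le].
      exists c2; split=> //; first by exists s2.
      by apply: (infinitesimalM R) => //; apply: infinitesimal_le i1.
    exists c1'; split=> //; first by exists s1.
    by apply: (infinitesimalM R) => //; apply: infinitesimal_le i2.
  + move=> f [Zf [c1' [Z1 p1 e1 i1]]]; split; first exact: (nsV nZ).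
    by exists c1'; split=> //; apply: infinitesimalV.
  + move=> f g [Zf [c1' [Z1 p1 [s1 e1] i1]]]; split; first exact: (nsJ nZ).
    exists (c1' ^ g)%g; split.
    * exact: (nsJ nZ).
    * by rewrite -(conj1g g); apply: bltJ.
    * by exists (A g^-1%g s1); rewrite actJ actVK e1.
    * exact: infinitesimalJ.
(* The nontrivial element is the commutator of [c] with a conjugate [e] fixing a point beyond the
   last fixed point of [c]: if they commuted, [c] would fix that point too. *)
- have [k hk] := act_beyond s z.
  pose e := (c ^ k^-1)%g.
  have Ze : Z e by apply: (nsJ nZ).
  have e1 : order_pos A 1%g e by rewrite -(conj1g k^-1%g); apply: bltJ.
  have ek : A e (A k s) = A k s by exact: actJV_fix.
  exists [~ c, e]%g.
    split; first exact: (nsR nZ).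
    have V1 m : order_pos A 1%g m -> ble (order_pos A) m^-1%g 1%g.
      by move=> h; rewrite -invg1; apply/bleV/blt_le.
    have between (m x : T) : order_pos A 1%g m -> order_pos A 1%g x ->
        ble (order_pos A) x m -> commensurable (order_pos A) m x.
      move=> m1 x1 xm; apply: commensurable_between => //.
      by apply: ble_trans (V1 _ m1) _; exact: blt_le.
    case: (bleNlt (order_pos A) c e) => [le|/blt_le le].
      exists e; split=> //; first by exists (A k s).
      by apply: (infinitesimalR R e1); apply: between => //; exact: ble_refl.
    exists c; split=> //; first by exists s.
    by apply: (infinitesimalR R c1); apply: between => //; exact: ble_refl.
  apply/negP => /commgP/commute_sym ce.
  have eN1 : e != 1%g.
    by apply: contra_notN (@blt_irr _ (order_pos A) e) => /eqP h; rewrite {1}h.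
  by have := hz _ hk; rewrite (commute_fix ce ek eN1) ltxx.
- move=> d0 s0 [Zd0 [c' [Zc' c'1 [s' e'] i0]]] e0.
  apply: contrapT => /eqP d01.
  have {d0 Zd0 e0 i0 d01} [d [Zd d1 ds inf]] : exists d, [/\ Z d, order_pos A 1%g d,
      A d s0 = s0 & infinitesimal (order_pos A) c' d].
    case: (blt_total (order_pos A) 1%g d0) => [e|h|h]; first by rewrite -e eqxx in d01.
      by exists d0.
    exists d0^-1%g; split; [exact: (nsV nZ)| |exact: actV_fix|exact: infinitesimalV].
    by rewrite -invg1; apply: bltV.
  have [zc [_ _ zcR]] := act_last_fixed_pos c'1 e'.
  have [yc [_ ycE ycL]] := Zfirst Zc' c'1 e'.
  have [zd [sd _ zdR]] := act_last_fixed_pos d1 ds.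
  have [yd [yd_s ydE ydL]] := Zfirst Zd d1 ds.
  have yczc : yc <= zc.
    by rewrite leNgt; apply/negP => /zcR; rewrite ycE ltxx.
  (* The first fixed point [A k yc] of the conjugate [e] then lies to the right of all fixed points
     of [c'] and [d]. *)
  have [k hk] := act_beyond yc (Num.max zc zd).
  pose e := (c' ^ k^-1)%g.
  have Ze : Z e by apply: (nsJ nZ).
  have e1 : order_pos A 1%g e by rewrite -(conj1g k^-1%g); apply: bltJ.
  have ek : A e (A k yc) = A k yc by exact: actJV_fix.
  have eL t : t < A k yc -> t < A e t.
    by move=> tk; rewrite actJV -actV_lt; apply: ycL; rewrite actV_lt.
  have [ze [yze zeE zeR]] := act_last_fixed_pos e1 ek.
  move: hk; rewrite gt_max => /andP[hc hd].
  have zcze := lt_le_trans hc yze.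
  have zdze := lt_le_trans hd yze.
  have ydzd := le_trans yd_s sd.
  have : ~ infinitesimal (order_pos A) e d.
    apply: (@left_not_infinitesimal d e yd ze) => //.
    - by move=> t ty; apply: eL; apply: le_lt_trans hd; apply: le_trans ydzd.
    - exact: le_lt_trans zdze.
    - exact: zdR.
  have : ~ infinitesimal (order_pos A) c' e.
    apply: (@right_not_infinitesimal c' e yc ze) => //.
    - by apply: eL; exact: le_lt_trans hc.
    - exact: le_lt_trans zcze.
    - exact: zcR.
  (* Negative powers of a positive [x] always lie below [v], so domination can only fail at a
     positive power. This yields [c' <= e ^+ m <= d ^+ (n * m)]. *)
  have key (v x : T) : order_pos A 1%g v -> order_pos A 1%g x ->
      ~ infinitesimal (order_pos A) v x -> exists n, ble (order_pos A) v (x ^+ n)%g.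
    move=> v1 x1 /existsNP[n /not_andP[h|[]]]; first by exists n.
    by apply: ble_lt_trans v1; rewrite -invg1; apply/bleV/ble1_exp/blt_le.
  move=> /(key _ _ c'1 e1)[m hm] /(key _ _ e1 d1)[n hn].
  have [lt1 _] := inf (n * m)%N.
  apply: (ble_trans hm _ lt1).
  by rewrite expgnA; apply: ble_exp.
Qed.

End NotExpanding.

End Core.

(** * Expanding elements *)

Section Push.
Variables (R : realType) (T : groupType) (A : line_action R T).
Implicit Types (d v w : T) (s t : R) (E : T -> Prop).

(** A high power [d ^+ N] is below [v] at the last fixed point of [d], above it one unit further,
    and below it again near +oo. The two crossings are distinct fixed points of [d ^- N * v], a
    member of [E]. *)
Lemma no_infinitesimal_push E d v s :
  (forall w s t, E w -> A w s = s -> A w t = t -> s = t) ->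
  (forall n, E (d ^- n * v)%g) ->
  order_pos A 1%g d -> A d s = s -> (forall t, s <= t -> t < A v t) ->
  ~ infinitesimal (order_pos A) v d.
Proof.
move=> single Ed d1 ds vs inf.
have [z [sz ez hz]] := act_last_fixed_pos d1 ds.
have zS : z < z + 1 by rewrite ltrDl.
have [N /(_ _ (leqnn _)) hN] := act_escape_right (A v (z + 1)) hz zS.
have [[M hM] _] := inf N.
have [x4M x4z] : M < Num.max M (z + 1) + 1 /\ z + 1 < Num.max M (z + 1) + 1.
  by split; apply: ltr_pwDr; rewrite // le_max lexx ?orbT.
have h0 : A (d ^+ N)%g z < A v z by rewrite actX_fix//; apply: vs.
have [a /andP[_ az] ea] := act_coincide zS h0 hN.
have [b /andP[zb _] eb] := act_coincide' x4z hN (hM _ x4M).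
by have := lt_trans az zb; rewrite (single _ _ _ (Ed N) ea eb) ltxx.
Qed.

End Push.

Section Expanding.
Variables (R : realType) (T : groupType) (A : line_action R T).
Hypothesis dense : forall x a b, a < b -> exists g, a < A g x < b.
Implicit Types (f g h k c d e v w : T) (s t x y z : R) (D Z E : T -> Prop).

Definition expanding v := order_pos A 1%g v /\ order_neg A 1%g v.

Definition dominates v d :=
  infinitesimal (order_pos A) v d /\ infinitesimal (order_neg A) v d.

Definition dominated Z E d := Z d /\ exists2 v, E v & dominates v d.

Lemma ble_mul1r (o : biorder T) (x y : T) : o 1%g y -> ble o x (x * y)%g.
Proof. by move=> /(blt_mull x)/blt_le; rewrite mulg1. Qed.

Lemma ble_mul1l (o : biorder T) (x y : T) : o 1%g y -> ble o x (y * x)%g.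
Proof. by move=> /(blt_mulr x)/blt_le; rewrite mul1g. Qed.

Lemma expandingM v w : expanding v -> expanding w -> expanding (v * w)%g.
Proof.
by move=> [v1 v2] [w1 w2]; split; [apply: blt_le_trans v1 _|apply: blt_le_trans v2 _];
  apply: ble_mul1r.
Qed.

Lemma expandingJ v g : expanding v -> expanding (v ^ g)%g.
Proof. by move=> [v1 v2]; split; rewrite -(conj1g g); apply: bltJ. Qed.

Lemma dominates_mulr v w d : expanding w -> dominates v d -> dominates (v * w)%g d.
Proof.
move=> [w1 w2] [d1 d2]; split.
  by apply: infinitesimal_le d1; apply: ble_mul1r.
by apply: infinitesimal_le d2; apply: ble_mul1r.
Qed.

Lemma dominates_mull v w d : expanding w -> dominates v d -> dominates (w * v)%g d.
Proof.
move=> [w1 w2] [d1 d2]; split.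
  by apply: infinitesimal_le d1; apply: ble_mul1l.
by apply: infinitesimal_le d2; apply: ble_mul1l.
Qed.

Lemma dominatesM v d d' : expanding v -> dominates v d -> dominates v d' ->
  dominates v (d * d')%g.
Proof.
by move=> [v1 v2] [d1 d2] [e1 e2]; split; apply: (infinitesimalM R).
Qed.

Lemma dominatesJ v d g : dominates v d -> dominates (v ^ g)%g (d ^ g)%g.
Proof. by move=> [d1 d2]; split; apply: infinitesimalJ. Qed.

Lemma dominatesV v d : dominates v d -> dominates v d^-1%g.
Proof. by move=> [d1 d2]; split; apply: infinitesimalV. Qed.

(** At each end [v] and [w] lie between [(v * w)^-1] and [v * w], so both are commensurable with the
    product. *)
Lemma dominatesR v w : expanding v -> expanding w -> dominates (v * w)%g [~ v, w]%g.
Proof.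
have key (o : biorder T) f g : o 1%g f -> o 1%g g ->
    infinitesimal o (f * g)%g [~ f, g]%g.
  move=> f1 g1.
  have fg1 : o 1%g (f * g)%g by apply: blt_le_trans f1 _; apply: ble_mul1r.
  have V1 : ble o (f * g)^-1%g 1%g by rewrite -[1%g]invg1; apply/bleV/blt_le.
  apply: (infinitesimalR R) => //; apply: commensurable_between.
  - by apply: ble_trans V1 _; apply: blt_le.
  - exact: ble_mul1r.
  - by apply: ble_trans V1 _; apply: blt_le.
  - exact: ble_mul1l.
by move=> [v1 v2] [w1 w2]; split; apply: key.
Qed.

Lemma expanding_neq1 v : expanding v -> v != 1%g.
Proof.
by move=> [v1 _]; apply: contra_notN (@blt_irr _ (order_pos A) v) => /eqP h; rewrite {1}h.
Qed.

(** [v^-1] maps a large interval into itself, which yields a fixed point, hence a first and a last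
    one. *)
Lemma expanding_fixed v : expanding v -> exists y z,
  [/\ A v y = y, A v z = z, y <= z, (forall t, t < y -> A v t < t) &
      (forall t, z < t -> t < A v t)].
Proof.
move=> [v1 v2]; have [M hM] := (order_negE _ _ _).1 v2; have [M' hM'] := v1.
have x1 : Num.min M M' - 1 < M by rewrite ltrBlDr ltr_pwDr// ge_min lexx.
have x2 : M' < Num.max M M' + 1 by apply: ltr_pwDr; rewrite // le_max lexx orbT.
have x12 : Num.min M M' - 1 < Num.max M M' + 1.
  by apply: (lt_trans x1); apply: ltr_pwDr; rewrite // le_max lexx.
have [s _ /actV_fix] : exists2 s, Num.min M M' - 1 < s < Num.max M M' + 1 &
    A v^-1%g s = s.
  apply: act_fixed_between => //; rewrite actV_lt actV_gt.
  by have := hM _ x1; have := hM' _ x2; rewrite !act1.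
rewrite invgK => es; have [z [sz ez hz]] := act_last_fixed_pos v1 es.
have [y [ys ey hy]] := act_first_fixed v2 es.
by exists y, z; split=> //; exact: le_trans sz.
Qed.

(** * Elements dominated by a conjugation-invariant semigroup of expanding elements *)

Section Dominated.
Variables (Z E : T -> Prop).
Hypothesis nZ : normal_subgroup Z.
Hypothesis EK : forall v, E v -> expanding v.
Hypothesis EM : forall v w, E v -> E w -> E (v * w)%g.
Hypothesis EJ : forall v g, E v -> E (v ^ g)%g.

Lemma dominated_normal v : E v -> normal_subgroup (dominated Z E).
Proof.
move=> Ev; split.
- split; first exact: (ns1 nZ).
  by exists v => //; have [v1 v2] := EK Ev; split; apply: infinitesimal1.
- move=> f g [Zf [v1 E1 d1]] [Zg [v2 E2 d2]]; split; first exact: (nsM nZ).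
  exists (v1 * v2)%g; first exact: EM.
  apply: dominatesM; first by apply: expandingM; apply: EK.
    by apply: dominates_mulr d1; apply: EK.
  by apply: dominates_mull d2; apply: EK.
- move=> f [Zf [v1 E1 d1]]; split; first exact: (nsV nZ).
  by exists v1 => //; apply: dominatesV.
- move=> f g [Zf [v1 E1 d1]]; split; first exact: (nsJ nZ).
  by exists (v1 ^ g)%g; [apply: EJ|apply: dominatesJ].
Qed.

(** Conjugate [v] so that a fixed point lands beyond the last fixed point of [v]; the two elements
    cannot commute, and their product dominates their commutator. *)
Lemma dominated_neq1 v : E v -> Z v -> exists2 d, dominated Z E d & d != 1%g.
Proof.
move=> Ev Zv; have Kv := EK Ev; have [y [z [vy _ _ _ hz]]] := expanding_fixed Kv.
have [k hk] := act_beyond dense y z.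
have Kw := expandingJ k^-1%g Kv.
exists [~ v, v ^ k^-1]%g.
  split; first exact: (nsR nZ).
  by exists (v * v ^ k^-1)%g; [apply: EM => //; apply: EJ|apply: dominatesR].
apply/negP => /commgP/commute_sym ce.
by have := hz _ hk; rewrite (commute_fix ce (actJV_fix k vy) (expanding_neq1 Kw)) ltxx.
Qed.

End Dominated.

(* Let [y < z] be the extreme fixed points of [w].  Conjugates [w1], [w2] of [w]
   with an extreme fixed point inside [y, z] and beyond that point yield an [F] that
   maps [y, z] into its interior and whose inverse still dominates [w].  Then
   [F^-1] crosses a high power of [w] once between [F y] and [F z], once on
   either side, and once more near +oo. *)
Lemma dominated_expanding_single Z w s t : dominated Z expanding w -> expanding w ->
  A w s = s -> A w t = t -> s = t.
Proof.
move=> [_ [g Kg [gw _]]] Kw es et.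
have [y [z [ey ez yz hy hz]]] := expanding_fixed Kw.
have inyz u : A w u = u -> y <= u <= z.
  move=> eu; rewrite !leNgt; apply/andP; split; apply/negP.
    by move=> /hy; rewrite eu ltxx.
  by move=> /hz; rewrite eu ltxx.
suff yz' : y = z.
  have := inyz _ es; have := inyz _ et; rewrite -yz' -!eq_le.
  by move=> /eqP <- /eqP <-.
move: yz; rewrite le_eqVlt => /orP[/eqP //|yz]; exfalso.
have [k /andP[yk kz]] := dense z yz.
have [k2 hk2] := act_beyond dense y (A k z).
pose w1 := (w ^ k^-1)%g; pose w2 := (w ^ k2^-1)%g.
have w1E : A w1 (A k z) = A k z by exact: actJV_fix.
have w1R u : A k z < u -> u < A w1 u.
  by move=> ku; rewrite actJV -actV_lt; apply: hz; rewrite actV_gt.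
have w2L u : u < A k2 y -> A w2 u < u.
  by move=> ku; rewrite actJV -actV_gt; apply: hy; rewrite actV_lt.
have [Kg1 Kg2] := (expandingJ k^-1%g Kg, expandingJ k2^-1%g Kg).
(* The product [G] of [g] with its two conjugates dominates [w], [w1] and [w2] simultaneously at
   +oo. *)
pose g1 := (g * g ^ k^-1)%g; pose G := (g1 * g ^ k2^-1)%g.
have Kg1' : expanding g1 by exact: expandingM.
have [G1 _] : expanding G by exact: expandingM.
have g1G : ble (order_pos A) g1 G by apply: ble_mul1r; case: Kg2.
have Gw : infinitesimal (order_pos A) G w.
  apply: infinitesimal_le gw; apply: ble_trans g1G.
  by apply: ble_mul1r; case: Kg1.
have Gw1 : infinitesimal (order_pos A) G w1.
  apply: infinitesimal_le (infinitesimalJ k^-1%g gw); apply: ble_trans g1G.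
  by apply: ble_mul1l; case: Kg.
have Gw2 : infinitesimal (order_pos A) G w2.
  apply: infinitesimal_le (infinitesimalJ k2^-1%g gw).
  by apply: ble_mul1l; case: Kg1'.
(* [w2 ^- n] carries the image of [[y, z]] under [G^-1] beyond [A k z]; then [w1 ^- m], which fixes
   [A k z], pulls it back below [z]. *)
have [n /(_ _ (leqnn _)) hn] := act_attract_left (A G^-1%g y) w2L hk2.
have [m /(_ _ (leqnn _)) hm] :=
  act_attract_right (A (w2 ^- n)%g (A G^-1%g z)) w1R kz.
pose u := (w1 ^- m * w2 ^- n)%g; pose F := (u * G^-1)%g.
have Fy : A k z < A F y by rewrite !actM -{1}(actXV_fix m w1E) act_ltE.
have Fz : A F z < z by rewrite !actM.
have yS : y - 1 < y by rewrite ltrBlDr ltrDl.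
have zS : z < z + 1 by rewrite ltrDl.
have [N1 h1] := act_escape_left (A F^-1%g (y - 1)) hy yS.
have [N2 h2] := act_escape_right (A F^-1%g (z + 1)) hz zS.
pose N := (N1 + N2)%N.
have hN1 := h1 N (leq_addr _ _).
have hN2 := h2 N (leq_addl _ _).
(* [F^-1 = G * u^-1], and [w ^+ N * u] is still infinitesimal relative to [G]. *)
have [M hM] : order_pos A (w ^+ N)%g F^-1%g.
  have i1 := infinitesimalV (infinitesimalX m Gw1).
  have i2 := infinitesimalV (infinitesimalX n Gw2).
  have i3 : infinitesimal (order_pos A) G (w ^+ N * u)%g.
    exact: (infinitesimalM R G1 (infinitesimalX N Gw) (infinitesimalM R G1 i1 i2)).
  have -> : F^-1%g = (G * u^-1)%g by rewrite invgM invgK.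
  by have := blt_mulr u^-1%g (proj1 (i3 1%N)); rewrite expg1 mulgK.
have [x4M x4z] : M < Num.max M (z + 1) + 1 /\ z + 1 < Num.max M (z + 1) + 1.
  by split; apply: ltr_pwDr; rewrite // le_max lexx ?orbT.
have yFy : y < A F y by apply: lt_trans yk Fy.
(* At [F y] and [F z] the map [F^-1] takes the values [y] and [z], which are fixed by [w ^+ N]. *)
apply: (act_alternate5 (x1 := A F y) (x2 := A F z) _ _ _ x4z hN1 _ _ hN2 (hM _ x4M)).
- by apply: lt_trans yFy; rewrite ltrBlDr ltrDl.
- by rewrite act_ltE; exact: yz.
- by apply: lt_trans Fz _; rewrite ltrDl.
- by rewrite actK -{1}(actX_fix N ey) act_ltE.
- by rewrite actK -{2}(actX_fix N ez) act_ltE.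
Qed.


(** * Expanding elements with a single fixed point *)

Section Iterated.
Variable Z : T -> Prop.
Hypothesis nZ : normal_subgroup Z.
Let E v := Z v /\ expanding v.
Hypothesis single : forall v s t, E v -> A v s = s -> A v t = t -> s = t.

Let EK v : E v -> expanding v. Proof. by case. Qed.

Let EM v w : E v -> E w -> E (v * w)%g.
Proof. by move=> [? ?] [? ?]; split; [apply: (nsM nZ)|apply: expandingM]. Qed.

Let EJ v g : E v -> E (v ^ g)%g.
Proof. by move=> [? ?]; split; [apply: (nsJ nZ)|apply: expandingJ]. Qed.

Let E_sub v d n : E v -> Z d -> dominates v d -> E (d ^- n * v)%g.
Proof.
move=> [Zv [v1 v2]] Zd [d1 d2]; split.
  by apply: (nsM nZ) => //; apply: (nsV nZ); apply: (nsX nZ).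
by split; rewrite -(mulVg (d ^+ n)%g); apply: blt_mull; [case: (d1 n)|case: (d2 n)].
Qed.

(** If [s] lay on one side of the unique fixed point of [v], the push argument at that end, applied
    to [d] or [d^-1], would contradict domination. The left side uses the reflected action. *)
Let dominated_fix v d s : E v -> Z d -> d != 1%g -> dominates v d -> A d s = s ->
  A v s = s.
Proof.
move=> Ev Zd d1 vd ds.
have [y [z [ey ez _ hy hz]]] := expanding_fixed (EK Ev).
have yz := single Ev ey ez; subst z.
case: (ltgtP s y) => [sy|ys|-> //]; exfalso.
- have vL t : - s <= t -> t < refl_action A v t.
    rewrite lerNl => ts; rewrite /= ltrNr; apply: hy.
    exact: le_lt_trans sy.
  have singleN w a b : E w -> refl_action A w a = a -> refl_action A w b = b -> a = b.
    move=> Ew /= ea eb; apply: oppr_inj; apply: (single Ew).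
      by rewrite -[LHS]opprK ea.
    by rewrite -[LHS]opprK eb.
  have dsN : refl_action A d (- s) = - s by rewrite /= opprK ds.
  case: (blt_total (order_neg A) 1%g d) => [e|h|h].
  + by rewrite -e eqxx in d1.
  + apply: (no_infinitesimal_push singleN _ h dsN vL); last by case: vd.
    by move=> n; apply: E_sub.
  + have h' : order_neg A 1%g d^-1%g by rewrite -invg1; apply: bltV.
    apply: (no_infinitesimal_push singleN _ h' (actV_fix dsN) vL).
      by move=> n; apply: E_sub; [|apply: (nsV nZ)|apply: dominatesV].
    by case: (dominatesV vd).
- have vR t : s <= t -> t < A v t by move=> st; apply: hz; apply: lt_le_trans st.
  case: (blt_total (order_pos A) 1%g d) => [e|h|h].
  + by rewrite -e eqxx in d1.
  + apply: (no_infinitesimal_push single _ h ds vR); last by case: vd.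
    by move=> n; apply: E_sub.
  + have h' : order_pos A 1%g d^-1%g by rewrite -invg1; apply: bltV.
    apply: (no_infinitesimal_push single _ h' (actV_fix ds) vR).
      by move=> n; apply: E_sub; [|apply: (nsV nZ)|apply: dominatesV].
    by case: (dominatesV vd).
Qed.

(** If a dominated [d] fixed [s], a conjugate would fix some [A k s > s]. The product [w * w ^ k^-1]
    dominates both elements, hence would fix both points. *)
Lemma free_normal_single v : E v -> has_free_normal A.
Proof.
move=> Ev; exists (dominated Z E); split.
- exact: (dominated_normal nZ EK EM EJ Ev).
- by apply: (dominated_neq1 nZ EK EM EJ Ev); case: Ev.
- move=> d s [Zd [w Ew wd]] ds; apply: contrapT => /eqP d1.
  have [k sk] := act_beyond dense s s.
  have Ewk := EJ k^-1%g Ew; have Ev' := EM Ew Ewk.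
  have e1 : A (w * w ^ k^-1)%g s = s.
    by apply: (dominated_fix Ev' Zd d1) => //; apply: dominates_mulr => //; apply: EK.
  have e2 : A (w * w ^ k^-1)%g (A k s) = A k s.
    apply: (dominated_fix (d := (d ^ k^-1)%g) Ev').
    + exact: (nsJ nZ).
    + by rewrite conjg_eq1.
    + by apply: dominates_mull; [apply: EK|apply: dominatesJ].
    + exact: actJV_fix.
  by move: sk; rewrite -(single Ev' e1 e2) ltxx.
Qed.

End Iterated.

Lemma free_normal_exists : has_free_normal A.
Proof.
have nT : normal_subgroup (fun _ : T => True) by split.
case: (EM (exists2 c, c != 1%g & exists s, A c s = s)); last first.
  (* No nontrivial element has a fixed point, so the whole group acts freely; it is nontrivial
     because some element moves [0]. *)
  move=> hN; exists (fun=> True); split=> //.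
    have [g /andP[g0 _]] := dense 0 ltr01.
    by exists g => //; apply: contraTneq g0 => ->; rewrite act1 ltxx.
  by move=> d s _ ds; apply: contrapT => /eqP d1; apply: hN; exists d => //; exists s.
move=> [c c1 [s cs]].
case: (EM (exists v, expanding v)) => [[v Kv]|hN]; last first.
  apply: (free_normal_not_expanding dense nT _ I c1 cs) => d _ hd.
  by apply: hN; exists d.
pose Z := dominated (fun=> True) expanding.
have idK w : expanding w -> expanding w by [].
have nZ : normal_subgroup Z.
  exact: (dominated_normal nT idK expandingM expandingJ Kv).
case: (EM (exists w, Z w /\ expanding w)) => [[w Ew]|hZ].
  apply: (free_normal_single nZ _ Ew) => u a b [Zu Ku].
  exact: dominated_expanding_single Zu Ku.
case: (EM (exists2 d, Z d & d != 1%g /\ exists s, A d s = s)).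
  move=> [d Zd [d1 [t dt]]].
  by apply: (free_normal_not_expanding dense nZ _ Zd d1 dt) => e Ze Ke; apply: hZ; exists e.
move=> hF; exists Z; split=> //.
  exact: (dominated_neq1 nT idK expandingM expandingJ Kv I).
move=> d t Zd dt; apply: contrapT => /eqP d1.
by apply: hF; exists d => //; split=> //; exists t.
Qed.

End Expanding.

(** * From a free normal subgroup to an affine action *)

Section Holder.
Variables (R : realType) (T : groupType) (A : line_action R T).
Hypothesis dense : forall x a b, a < b -> exists g, a < A g x < b.
Implicit Types (f g d e : T) (r s t x y : R).

Section FreeNormal.
Variable D : T -> Prop.
Hypothesis nD : normal_subgroup D.
Hypothesis fD : free A D.

(** Graphs of distinct elements of a free subgroup never meet, so their order near +oo holds
    everywhere. *)
Lemma free_lt f g x : D f -> D g -> order_pos A f g -> A f x < A g x.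
Proof.
move=> Df Dg fg.
have key y : A (f^-1 * g)%g y = y -> False.
  move/(fD (nsM nD (nsV nD Df) Dg))/mulg1_eq; rewrite invgK => e.
  by move: fg; rewrite e => /blt_irr.
case: (ltgtP (A f x) (A g x)) => // [gf|e]; exfalso; last first.
  by apply: (key x); rewrite actM -e actK.
have [M hM] := fg.
have [Mw xw] : M < Num.max M x + 1 /\ x < Num.max M x + 1.
  by split; apply: ltr_pwDr; rewrite // le_max lexx ?orbT.
by have [z _ /key] := act_coincide' xw gf (hM _ Mw).
Qed.

Lemma free_ltV f g x : D f -> D g -> A f x < A g x -> order_pos A f g.
Proof.
move=> Df Dg h; case: (blt_total (order_pos A) f g) => // [e|gf].
  by move: h; rewrite e ltxx.
by have := lt_trans h (free_lt x Dg Df gf); rewrite ltxx.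
Qed.

Lemma free_leV f g x : D f -> D g -> A f x <= A g x -> ble (order_pos A) f g.
Proof. by move=> Df Dg h /(free_lt x Dg Df); rewrite ltNge h. Qed.

End FreeNormal.

(** Without a least positive element, translation numbers will be dense in the line. If the whole
    group is free, dense orbits give small elements; otherwise a least positive element would
    commute with some nontrivial [c] having a fixed point. *)
Lemma free_normal_nondiscrete : exists D, [/\ normal_subgroup D,
  (exists2 d, D d & order_pos A 1%g d), free A D &
  forall d, D d -> order_pos A 1%g d ->
    exists e, [/\ D e, order_pos A 1%g e & order_pos A e d]].
Proof.
have nT : normal_subgroup (fun _ : T => True) by split.
case: (EM (free A (fun=> True))) => [fT|].
  have pos d : order_pos A 1%g d -> 0 < A d 0.
    by move=> d1; rewrite -[ltLHS](act1 A); apply: (free_lt nT fT).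
  have ex d : 0 < A d 0 -> exists e, [/\ True, order_pos A 1%g e & order_pos A e d].
    move=> d0; have [e /andP[e0 ed]] := dense 0 d0; exists e; split=> //.
      by apply: (free_ltV (x := 0) nT fT) => //; rewrite act1.
    exact: (free_ltV (x := 0) nT fT).
  exists (fun=> True); split=> //; last by move=> d _ /pos/ex.
  have [g /andP[g0 _]] := dense 0 ltr01.
  by have [e [_ e1 _]] := ex _ g0; exists e.
move=> /existsNP[c /existsNP[s /not_implyP[_ /not_implyP[cs c1]]]].
have [D [nD [d0 Dd0 d01] fD]] := free_normal_exists dense.
exists D; split=> //.
  case: (blt_total (order_pos A) 1%g d0) => [e|h|h].
  - by rewrite -e eqxx in d01.
  - by exists d0.
  - by exists d0^-1%g; [exact: (nsV nD)|rewrite -invg1; apply: bltV].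
move=> d Dd d1; apply: contrapT => hN.
have le g : ble (order_pos A) d (d ^ g)%g.
  move=> lt; apply: hN; exists (d ^ g)%g; split=> //; first exact: (nsJ nD).
  by rewrite -(conj1g g); apply: bltJ.
have dJ g : (d ^ g)%g = d.
  apply: (@ble_anti _ (order_pos A)); last exact: le.
  by move=> /(bltJ g^-1%g); rewrite conjgK => /le.
(* A least positive element is central, so it inherits the fixed points of [c]. *)
have cd : commute c d by rewrite /commute [RHS]conjgC dJ.
have ds : A d s = s by apply: (commute_fix cd cs); apply/eqP.
by move: d1; rewrite (fD _ _ Dd ds) => /blt_irr.
Qed.

(** * The monotone map defined by translation numbers *)

Section Semiconjugacy.
Variables (D : T -> Prop) (v : T).
Hypotheses (nD : normal_subgroup D) (fD : free A D).
Hypotheses (Dv : D v) (v1 : order_pos A 1%g v).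
Hypothesis nondiscrete : forall d, D d -> order_pos A 1%g d ->
  exists e, [/\ D e, order_pos A 1%g e & order_pos A e d].

Local Notation tau := (tau R (order_pos A) v).

Let DX n d : D d -> D (d ^+ n)%g. Proof. exact: nsX. Qed.
Let DXV n d : D d -> D (d ^- n)%g. Proof. by move=> h; apply/(nsV nD)/DX. Qed.

Let cofinal d x y : D d -> order_pos A 1%g d -> exists n, y < A (d ^+ n)%g x.
Proof.
move=> Dd d1; have dt t : t < A d t.
  by rewrite -[ltLHS](act1 A); apply: (free_lt nD fD) => //; exact: (ns1 nD).
by have [N /(_ _ (leqnn _))] := @act_escape _ _ A d x y (dt x) (fun t _ _ => dt t); exists N.
Qed.

Let comm d : D d -> commensurable (order_pos A) v d.
Proof.
move=> Dd; have [m hm] := cofinal 0 (A d 0) Dv v1.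
have [n hn] := cofinal (A d 0) 0 Dv v1.
have le1 k : ble (order_pos A) 1%g (v ^+ k)%g by apply/ble1_exp/blt_le.
exists (m + n)%N; split.
  rewrite zexpN /= -[d]invgK; apply: bleV; rewrite expgnDr -[d^-1%g]mul1g.
  apply: ble_mul => //; apply: (free_leV (x := A d 0) nD fD); rewrite ?actK ?ltW//.
  + exact: (nsV nD).
  + exact: DX.
rewrite /= expgnDr -[d]mulg1; apply: ble_mul => //.
by apply: (free_leV (x := 0) nD fD) => //; [exact: DX|exact: ltW].
Qed.

Let tau_gt0 d : D d -> order_pos A 1%g d -> 0 < tau d.
Proof.
move=> Dd d1; rewrite lt_neqAle; apply/andP; split; last first.
  rewrite -(tau1 R v1); apply: (tau_mono R v1); [exact: commensurable1|exact: comm|exact: blt_le].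
apply/eqP => /esym t0; have inf : infinitesimal (order_pos A) v d.
  by apply/(infinitesimalP R v1); split=> //; exact: comm.
have [n hn] := cofinal 0 (A v 0) Dd d1.
have := free_lt nD fD 0 (DX n Dd) Dv (proj1 (inf n)).
by rewrite ltNge ltW.
Qed.

Let tau_le' d e : D d -> D e -> A d 0 <= A e 0 -> tau d <= tau e.
Proof.
move=> Dd De h; apply: (tau_mono R v1); [exact: comm|exact: comm|].
exact: (free_leV (x := 0) nD fD).
Qed.

Let tauB d e : D d -> D e -> tau (d^-1 * e)%g = tau e - tau d.
Proof.
move=> Dd De; rewrite (tauM R v1) ?(tauV R v1) 1?addrC//; do ?exact: comm.
by apply: comm; apply: (nsV nD).
Qed.

Let tau_lt d e : D d -> D e -> tau d < tau e -> A d 0 < A e 0.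
Proof. by move=> Dd De; rewrite !ltNge; apply: contra; exact: tau_le'. Qed.

(** Split [e] as [e' * (e'^-1 * e)] with both factors positive: one of them has at most half the
    translation number. *)
Let tau_small n : exists e, [/\ D e, order_pos A 1%g e & n.+1%:R * tau e <= 1].
Proof.
elim: n => [|n [e [De e1 le]]].
  by exists v; split=> //; rewrite mul1r (tau_self R v1).
have [e' [De' e'1 e'e]] := nondiscrete De e1.
have De'' : D (e'^-1 * e)%g by apply: (nsM nD) => //; apply: (nsV nD).
have e''1 : order_pos A 1%g (e'^-1 * e)%g.
  by rewrite -(mulVg e'); apply: blt_mull.
have t1 := tau_gt0 De' e'1; have t2 := tau_gt0 De'' e''1.
have tE := tauB De' De.
have half d : 0 < tau d -> tau d * 2 <= tau e -> n.+2%:R * tau d <= 1.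
  move=> d0 h; apply: le_trans le; apply: (@le_trans _ _ (n.+1%:R * (tau d * 2))).
    rewrite mulrCA mulrC ler_pM2l//.
    by rewrite -natrM ler_nat muln2 -addnn -addn1 leq_add2l.
  by rewrite ler_wpM2l.
case: (leP (tau e' * 2) (tau e)) => h; first by exists e'; split=> //; apply: half.
by exists (e'^-1 * e)%g; split=> //; apply: half => //; lra.
Qed.

Let tau_zexp d (z : int) : D d -> tau (zexp d z) = z%:~R * tau d.
Proof.
move=> /comm hd; case: z => n /=; first by rewrite (tauX R v1).
by rewrite (tauV R v1) ?(tauX R v1)// ?NegzE ?rmorphN ?mulNr//; apply: commensurableX.
Qed.

Let tau_dense r s : r < s -> exists2 d, D d & r < tau d < s.
Proof.
move=> rs; have [q q0 hq] : exists2 q : nat, (0 < q)%N & q%:R^-1 < s - r.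
  by apply: exists_invn_lt; rewrite subr_gt0.
have [e [De e1]] := tau_small q.-1; rewrite prednK// => he.
have t0 := tau_gt0 De e1.
have ts : tau e < s - r.
  apply: le_lt_trans hq; rewrite -[leRHS]mul1r ler_pdivlMr ?ltr0n//.
  by rewrite mulrC.
(* The first integer multiple of [tau e] exceeding [r]; the step is too short to jump over [s]. *)
pose z := Num.floor (r / tau e) + 1.
exists (zexp e z); first by case: (z) => n; [exact: DX|exact: DXV].
rewrite tau_zexp//; apply/andP; split.
  by rewrite -ltr_pdivrMr// floorD1_gt.
have : (Num.floor (r / tau e))%:~R * tau e <= r by rewrite -ler_pdivlMr// floor_le.
rewrite /z intrD mulrDl mul1r; lra.
Qed.

Let tauJ_gt0 g : 0 < tau (v ^ g)%g.
Proof.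
apply: tau_gt0; first exact: (nsJ nD).
by rewrite -(conj1g g); apply: bltJ.
Qed.

(** Conjugation preserves the order, so a comparison of a power of [v] with a power of [d] passes to
    their conjugates. Applied to [d] and [d^-1], this shows that conjugation rescales [tau]. *)
Let tauJ_ge g d : D d -> tau (v ^ g)%g * tau d <= tau (d ^ g)%g.
Proof.
move=> Dd; rewrite mulrC -ler_pdivlMr//; apply: tau_le_ub => //; first exact: comm.
move=> z q q0 h; rewrite ler_pdivlMr// mulrAC ler_pdivrMr ?ltr0n//.
have zJ : (zexp v z ^ g)%g = zexp (v ^ g)%g z.
  by case: (z) => n /=; rewrite ?conjVg conjXg.
rewrite -tau_zexp; last exact: (nsJ nD).
rewrite -zJ mulrC -(tauX R v1); last by apply: comm; apply: (nsJ nD).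
have Dz : D (zexp v z) by case: (z) => n; [exact: DX|exact: DXV].
apply: (tau_mono R v1).
- by apply: comm; apply: (nsJ nD).
- by apply/comm/DX/(nsJ nD).
- by rewrite -conjXg => /(bltJ g^-1%g); rewrite !conjgK.
Qed.

Let tauJ g d : D d -> tau (d ^ g)%g = tau (v ^ g)%g * tau d.
Proof.
move=> Dd; apply/eqP; rewrite eq_le tauJ_ge// andbT.
have := tauJ_ge g (nsV nD Dd).
rewrite conjVg !(tauV R v1) ?mulrN ?lerN2//;
  by apply: comm => //; apply: (nsJ nD).
Qed.

(** The monotone extension to the line of [A d 0 |-> tau d], defined on the [D]-orbit of [0]. *)
Definition theta x := sup [set r | exists2 d, D d /\ A d 0 <= x & r = tau d].

Let theta_sup x : has_sup [set r | exists2 d, D d /\ A d 0 <= x & r = tau d].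
Proof.
split.
  have [n hn] := cofinal x 0 Dv v1.
  exists (tau (v ^- n)%g), (v ^- n)%g => //; split; first exact: DXV.
  by rewrite ltW// actV_lt.
have [n hn] := cofinal 0 x Dv v1; exists (tau (v ^+ n)%g) => _ [d [Dd dx] ->].
by apply: tau_le' => //; [exact: DX|by apply: ltW; apply: le_lt_trans hn].
Qed.

Lemma theta_ge d x : D d -> A d 0 <= x -> tau d <= theta x.
Proof. by move=> Dd dx; apply: ub_le_sup; [case: (theta_sup x)|exists d]. Qed.

Lemma theta_le d x : D d -> x <= A d 0 -> theta x <= tau d.
Proof.
move=> Dd xd; apply: ge_sup; first by case: (theta_sup x).
by move=> _ [e [De ex] ->]; apply: tau_le' => //; exact: le_trans xd.
Qed.

(** By density some [tau d] would lie strictly between [theta x] and [t], whereas both respect the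
    position of [A d 0] relative to [x]. *)
Lemma theta_uniq x t : (forall d, D d -> A d 0 <= x -> tau d <= t) ->
  (forall d, D d -> x <= A d 0 -> t <= tau d) -> theta x = t.
Proof.
move=> h1 h2; case: (ltgtP (theta x) t) => // /tau_dense[d Dd /andP[a b]]; exfalso.
  case: (leP (A d 0) x) => [/(theta_ge Dd)|/ltW/(h2 _ Dd)]; lra.
case: (leP (A d 0) x) => [/(h1 _ Dd)|/ltW/(theta_le Dd)]; lra.
Qed.

Lemma theta_mono x y : x <= y -> theta x <= theta y.
Proof.
move=> xy; apply: ge_sup; first by case: (theta_sup x).
by move=> _ [d [Dd dx] ->]; apply: theta_ge => //; exact: le_trans xy.
Qed.

(** The preimage is the supremum of the orbit points [A d 0] with [tau d <= t]. *)
Lemma theta_surj t : exists x, theta x = t.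
Proof.
pose S := [set y | exists2 d, D d /\ tau d <= t & y = A d 0].
have S0 : S !=set0.
  have [|d Dd /andP[_ dt]] := @tau_dense (t - 1) t; first by rewrite ltrBlDr ltrDl.
  by exists (A d 0), d => //; split=> //; exact: ltW.
have Sub e : D e -> t < tau e -> ubound S (A e 0).
  by move=> De te _ [d [Dd dt] ->]; apply/ltW/tau_lt => //; exact: le_lt_trans te.
have bS : has_ubound S.
  have [|e De /andP[te _]] := @tau_dense t (t + 1); first by rewrite ltrDl.
  by exists (A e 0); exact: Sub.
exists (sup S); apply: theta_uniq => d Dd h; rewrite leNgt; apply/negP => td.
- have [e De /andP[te ed]] := tau_dense td.
  have := tau_lt De Dd ed; rewrite ltNge => /negP; apply.
  by apply: (le_trans h); apply: ge_sup => //; exact: Sub.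
- have [e De /andP[de et]] := tau_dense td.
  have := tau_lt Dd De de; rewrite ltNge => /negP; apply.
  apply: le_trans h; apply: ub_le_sup => //.
  by exists e => //; split=> //; exact: ltW.
Qed.

Lemma theta_translate e x : D e -> theta (A e x) = theta x + tau e.
Proof.
move=> De; apply: theta_uniq => d Dd h.
- rewrite -lerBlDr -tauB//; apply: theta_ge; first by apply: (nsM nD) => //; apply: (nsV nD).
  by rewrite actM -(act_leE A e) actVK.
- rewrite -lerBrDr -tauB//; apply: theta_le; first by apply: (nsM nD) => //; apply: (nsV nD).
  by rewrite actM -(act_leE A e) actVK.
Qed.

(** On the orbit of [0], [g d = (d ^ g^-1) g] turns the rescaling of [tau] by conjugation into an
    affine formula; [theta_uniq] extends it to every [x]. *)
Lemma theta_affine g : exists a b, 0 < a /\ forall x, theta (A g x) = a * theta x + b.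
Proof.
exists (tau (v ^ g^-1)%g), (theta (A g 0)); split=> // x.
have step d : D d -> theta (A g (A d 0)) = tau (v ^ g^-1)%g * tau d + theta (A g 0).
  move=> Dd; rewrite -tauJ// [RHS]addrC -theta_translate; last exact: (nsJ nD).
  by rewrite actJV actK.
have a0 := tauJ_gt0 g^-1%g.
suff -> : theta x = (theta (A g x) - theta (A g 0)) / tau (v ^ g^-1)%g.
  by rewrite mulrC divfK ?subrK ?gt_eqF.
apply: theta_uniq => d Dd h.
- by rewrite ler_pdivlMr// mulrC lerBrDr -step//; apply: theta_mono; rewrite act_leE.
- by rewrite ler_pdivrMr// mulrC lerBlDr -step//; apply: theta_mono; rewrite act_leE.
Qed.

End Semiconjugacy.

Theorem affine_semiconjugacy : exists th : R -> R,
  [/\ {homo th : x y / x <= y}, forall t, exists x, th x = t &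
      forall g, exists a b, 0 < a /\ forall x, th (A g x) = a * th x + b].
Proof.
have [D [nD [v Dv v1] fD nd]] := free_normal_nondiscrete.
exists (theta D v); split.
- exact: theta_mono.
- exact: theta_surj.
- exact: theta_affine.
Qed.

End Holder.

(** * Homeomorphism groups *)

Section HomeoGroup.
Variables (d : Order.disp_t) (X : POrderedTopological.type d) (G : set (X -> X)).

(** The alias carries the proof [hG], so that a group structure can be attached to the type. *)
Definition homeo_group (hG : homeo_subgroup G) := set_type G.

Variable hG : homeo_subgroup G.

HB.instance Definition _ := Choice.on (homeo_group hG).

Implicit Types f g h : homeo_group hG.

Lemma homeo_groupP f : G (val f). Proof. exact/set_mem/(valP f). Qed.

Definition homeo_elt (f : X -> X) (Gf : G f) : homeo_group hG := exist _ f (mem_set Gf).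

Lemma homeo_inv_ex f : exists g : homeo_group hG,
  cancel (val f) (val g) /\ cancel (val g) (val f).
Proof.
have [sG _ _ hV] := hG; have Gf := homeo_groupP f.
have [_ _ [g [fg gf _]]] := sG _ Gf.
by exists (homeo_elt (hV _ _ Gf fg gf)).
Qed.

Definition homeo_inv f := projT1 (cid (homeo_inv_ex f)).

Lemma homeo_invP f : cancel (val f) (val (homeo_inv f)) /\
  cancel (val (homeo_inv f)) (val f).
Proof. exact: projT2 (cid (homeo_inv_ex f)). Qed.

Definition homeo_mul f g : homeo_group hG :=
  let: And4 _ _ hM _ := hG in
  homeo_elt (hM _ _ (homeo_groupP f) (homeo_groupP g)).

Definition homeo_one : homeo_group hG :=
  let: And4 _ h1 _ _ := hG in homeo_elt h1.

Lemma val_homeo_mul f g : val (homeo_mul f g) = val f \o val g.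
Proof. by rewrite /homeo_mul; case: (hG). Qed.

Lemma val_homeo_one : val homeo_one = id.
Proof. by rewrite /homeo_one; case: (hG). Qed.

Let mulA : associative homeo_mul.
Proof. by move=> f g h; apply: val_inj; rewrite !val_homeo_mul. Qed.

Let mul1 : left_id homeo_one homeo_mul.
Proof. by move=> f; apply: val_inj; rewrite !val_homeo_mul val_homeo_one. Qed.

Let mulr1 : right_id homeo_one homeo_mul.
Proof. by move=> f; apply: val_inj; rewrite !val_homeo_mul val_homeo_one. Qed.

Let mulV : left_inverse homeo_one homeo_inv homeo_mul.
Proof.
move=> f; apply: val_inj; rewrite val_homeo_mul val_homeo_one.
by apply/funext => x /=; have [-> _] := homeo_invP f.
Qed.

Let mulrV : right_inverse homeo_one homeo_inv homeo_mul.
Proof.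
move=> f; apply: val_inj; rewrite val_homeo_mul val_homeo_one.
by apply/funext => x /=; have [_ ->] := homeo_invP f.
Qed.

HB.instance Definition _ :=
  isGroup.Build (homeo_group hG) mulA mul1 mulr1 mulV mulrV.

Lemma val_homeoM f g : val (f * g)%g = val f \o val g.
Proof. exact: val_homeo_mul. Qed.

Lemma val_homeo1 : val (1%g : homeo_group hG) = id.
Proof. exact: val_homeo_one. Qed.

End HomeoGroup.

(** Preimages of [th x - e / 2] and [th x + e / 2] bound a neighborhood of [x]. *)
Lemma mono_surj_continuous (R : realType) (th : R -> R) :
  {homo th : x y / x <= y} -> (forall t, exists x, th x = t) -> continuous th.
Proof.
move=> mono surj x; apply/cvgrPdist_lt => e e0.
have [y1 h1] := surj (th x - e / 2); have [y2 h2] := surj (th x + e / 2).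
have y1x : y1 < x.
  by rewrite ltNge; apply/negP => /mono; rewrite h1; lra.
have xy2 : x < y2.
  by rewrite ltNge; apply/negP => /mono; rewrite h2; lra.
near=> y.
have /mono : y1 <= y by apply/ltW; near: y; exact: lt_nbhsr.
have /mono : y <= y2 by apply/ltW; near: y; exact: lt_nbhsl.
rewrite h1 h2 => a b; rewrite ltr_norml; apply/andP; split; lra.
Unshelve. all: by end_near. Qed.

(** * From a homeomorphism group of the closed interval to an action on the line *)

Section Restriction.
Variables (R : realType) (Gamma : set (unit_cc R -> unit_cc R)).
Hypothesis hGamma : homeo_subgroup Gamma.
Local Notation T := (homeo_group hGamma).
Local Notation incl := (@incl_oo_cc R).
Implicit Types (f g h : T).

Lemma incl_lt x y : (incl x < incl y)%O = (x < y)%O.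
Proof. by rewrite -!lt_val. Qed.

Lemma homeo_lt g x y : (x < y)%O -> (val g x < val g y)%O.
Proof.
have [sG _ _ _] := hGamma; have [gm _ _] := sG _ (homeo_groupP g).
exact: gm.
Qed.

Let cc0 : (0 : R) \in `[0, 1]%classic.
Proof. by rewrite inE /= in_itv /= lexx ler01. Qed.
Let cc1 : (1 : R) \in `[0, 1]%classic.
Proof. by rewrite inE /= in_itv /= lexx ler01. Qed.

(** Strict monotonicity puts the image strictly between those of [0] and [1]. *)
Lemma homeo_interior g x : val (val g (incl x)) \in `]0, 1[%classic.
Proof.
have /set_mem /= := valP x; rewrite in_itv /= => /andP[x0 x1].
pose z0 : unit_cc R := exist _ 0 cc0; pose z1 : unit_cc R := exist _ 1 cc1.
have h0 : (val g z0 < val g (incl x))%O by apply: homeo_lt; rewrite -lt_val.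
have h1 : (val g (incl x) < val g z1)%O by apply: homeo_lt; rewrite -lt_val.
have /set_mem /= := valP (val g z0); rewrite in_itv /= => /andP[a0 _].
have /set_mem /= := valP (val g z1); rewrite in_itv /= => /andP[_ b1].
apply/mem_set; rewrite /= in_itv /=; apply/andP; split.
- by move: h0; rewrite -lt_val; exact: le_lt_trans a0.
- by move: h1; rewrite -lt_val => /lt_le_trans; exact.
Qed.

Definition restr g x : unit_oo R := exist _ (val (val g (incl x))) (homeo_interior g x).

Lemma incl_restr g x : incl (restr g x) = val g (incl x).
Proof. exact: val_inj. Qed.

Lemma incl_inj : injective incl.
Proof. by move=> x y /(congr1 val) /= h; exact: val_inj. Qed.

Lemma restrM f g x : restr (f * g)%g x = restr f (restr g x).
Proof. by apply: incl_inj; rewrite !incl_restr val_homeoM. Qed.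

Lemma restr1 x : restr 1%g x = x.
Proof. by apply: incl_inj; rewrite incl_restr val_homeo1. Qed.

Lemma restr_lt g x y : (x < y)%O -> (restr g x < restr g y)%O.
Proof. by rewrite -!incl_lt !incl_restr; exact: homeo_lt. Qed.

Lemma pullback_restr (h : unit_oo R -> unit_oo R) : pullback_action incl Gamma h <-> exists g, h = restr g.
Proof.
split=> [[g Gg e]|[g ->]].
  exists (homeo_elt hGamma Gg); apply/funext => x.
  by apply: incl_inj; rewrite incl_restr; exact: (congr1 (@^~ x) e).
exists (val g); first exact: homeo_groupP.
by apply/funext => x /=; rewrite incl_restr.
Qed.

Hypothesis hmin : minimal_set (pullback_action incl Gamma) setT.

(** Points whose orbit avoids the interval form a closed invariant set. It misses [c], so by
    minimality it cannot contain [x]. *)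
Lemma restr_dense (x a c b : unit_oo R) : (a < c)%O -> (c < b)%O ->
  exists g, (a < restr g x)%O && (restr g x < b)%O.
Proof.
move=> ac cb; apply: contrapT => /forallNP hN.
pose N := [set y | forall g, ~ (a < restr g y < b)%O].
have [_ _ _ /(_ N)] := hmin; apply.
- by exists x.
- have -> : N = \bigcap_(g in [set: T]) ~` [set y | (a < restr g y < b)%O].
    by apply/seteqP; split=> [y Ny g _|y Ny g]; [exact: Ny|exact: Ny g I].
  apply: closed_bigI => g _; apply: open_closedC.
  have -> : [set y | (a < restr g y < b)%O] =
      (fun y => val (val g (incl y))) @^-1` `]val a, val b[.
    apply/seteqP; split=> y /=; rewrite in_itv /= -!lt_val//.
  apply: open_comp; last exact: interval_open.
  move=> y _; apply: (@continuous_comp _ _ _ (val g \o incl) val).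
    apply: (@continuous_comp _ _ _ incl (val g)).
      apply: (@continuous_comp_initial (unit_cc R) _ R val incl).
      exact: initial_continuous.
    have [sG _ _ _] := hGamma; have [_ gc _] := sG _ (homeo_groupP g).
    exact: gc.
  exact: initial_continuous.
- move=> h /pullback_restr[g ->] _ [y Ny <-] f.
  by rewrite -restrM; exact: Ny.
- split=> // /(_ c I) /(_ 1%g); apply.
  by rewrite restr1 ac cb.
Qed.

Variable phi : R -> unit_oo R.
Hypothesis hphi : Homeo_plus R (unit_oo R) phi.

Let psi_ex : exists psi, cancel phi psi /\ cancel psi phi.
Proof. by have [_ _ [psi [h1 h2 _]]] := hphi; exists psi. Qed.

Definition line_coord := projT1 (cid psi_ex).
Local Notation psi := line_coord.

Let phiK : cancel phi psi. Proof. exact: (projT2 (cid psi_ex)).1. Qed.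
Let psiK : cancel psi phi. Proof. exact: (projT2 (cid psi_ex)).2. Qed.

Let phi_lt x y : (phi x < phi y)%O = (x < y).
Proof.
have [h _ _] := hphi.
case: (ltgtP x y) => [/h //|/h|->]; last by rewrite ltxx.
exact: lt_gtF.
Qed.

Definition line_act g x := psi (restr g (phi x)).

Let line_act1 x : line_act 1%g x = x.
Proof. by rewrite /line_act restr1 phiK. Qed.

Let line_actM f g x : line_act (f * g)%g x = line_act f (line_act g x).
Proof. by rewrite /line_act restrM psiK. Qed.

Let line_act_lt g x y : x < y -> line_act g x < line_act g y.
Proof. by rewrite -!phi_lt /line_act !psiK; exact: restr_lt. Qed.

Hypothesis hfix : forall g : unit_cc R -> unit_cc R, Gamma g -> g <> id ->
  ([set x : unit_oo R | g (incl x) = incl x] #<= `I_3)%card.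

Let line_act_fix4 g x1 x2 x3 x4 : x1 < x2 -> x2 < x3 -> x3 < x4 ->
  line_act g x1 = x1 -> line_act g x2 = x2 -> line_act g x3 = x3 ->
  line_act g x4 = x4 -> g = 1%g.
Proof.
move=> h12 h23 h34 e1 e2 e3 e4; apply: contrapT => g1.
have gid : val g <> id.
  by move=> e; apply: g1; apply: val_inj; rewrite e val_homeo1.
have := hfix (homeo_groupP g) gid.
(* [q] injects [I_4] into the fixed set, which [hfix] bounds by [I_3]. *)
pose xs := [:: x1; x2; x3; x4]; pose q (i : nat) := phi (nth 0 xs i).
have us : uniq xs.
  rewrite /= !inE !negb_or !lt_eqF//; do ?[exact: lt_trans h34].
  - by apply: lt_trans h34; apply: lt_trans h23.
  - exact: lt_trans h23.
have qinj : set_inj `I_4 q.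
  move=> i j /set_mem /= i4 /set_mem /= j4 /(can_inj phiK) /eqP.
  by rewrite nth_uniq// => /eqP.
have sub : q @` `I_4 `<=` [set x | val g (incl x) = incl x].
  move=> _ [i i4 <-] /=; rewrite -incl_restr; congr incl.
  have fx x : line_act g x = x -> restr g (phi x) = phi x.
    by move=> {2}<-; rewrite /line_act psiK.
  by move: i4; rewrite /q; case: i => [|[|[|[|]]]]//= _; apply: fx.
move=> /(card_le_trans (subset_card_le sub)).
by rewrite (card_le_eql (inj_card_eq qinj)) card_le_II.
Qed.

Definition line_homeo_action := LineAction line_act1 line_actM line_act_lt line_act_fix4.

Lemma line_act_dense x a b : a < b -> exists g, a < line_homeo_action g x < b.
Proof.
move=> ab; pose c := (a + b) / 2.
have ac : (phi a < phi c)%O by rewrite phi_lt /c; lra.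
have cb : (phi c < phi b)%O by rewrite phi_lt /c; lra.
have [g] := restr_dense (phi x) ac cb.
by exists g; rewrite -(phi_lt a) -(phi_lt _ b) /= /line_act psiK.
Qed.

Lemma pullback_line_act (f : R -> R) : pullback_action phi (pullback_action incl Gamma) f <->
  exists g, f = line_homeo_action g.
Proof.
split=> [[h /pullback_restr[g ->] e]|[g ->]].
  exists g; apply/funext => x /=; rewrite /line_act -[LHS]phiK.
  by congr psi; exact: (congr1 (@^~ x) e).
exists (restr g); first by apply/pullback_restr; exists g.
by apply/funext => x /=; rewrite /line_act psiK.
Qed.

End Restriction.

(** * The affine group as the image of a homomorphism *)

Section AffineImage.
Variables (R : realType) (T : groupType) (A : line_action R T) (G : set (R -> R)).
Hypothesis GA : forall f, G f <-> exists g, f = A g.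
Variable th : R -> R.
Hypothesis th_mono : {homo th : x y / x <= y}.
Hypothesis th_surj : forall t, exists x, th x = t.
Hypothesis th_affine : forall g, exists a b, 0 < a /\
  forall x, th (A g x) = a * th x + b.

Let image_affine f := exists ab : R * R, 0 < ab.1 /\
  th \o f = (fun x => ab.1 * x + ab.2) \o th.

(** The affine map is chosen classically, with [id] as the default where none exists. *)
Let rho f : R -> R := if pselect (image_affine f) is left e
  then fun x => (projT1 (cid e)).1 * x + (projT1 (cid e)).2 else id.

Let rhoP f : G f -> exists a b, [/\ 0 < a, rho f = (fun x => a * x + b) &
  th \o f = rho f \o th].
Proof.
move=> /GA[g ->]; rewrite /rho; case: pselect => [e|[]].
  by case: (cid e) => -[a b] [/= a0 hab]; exists a, b.
by have [a [b [a0 h]]] := th_affine g; exists (a, b); split=> //; apply/funext => x /=.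
Qed.

(** Surjectivity of [th] leaves a single choice, which makes [rho] multiplicative. *)
Let rho_uniq f u : G f -> th \o f = u \o th -> u = rho f.
Proof.
move=> /rhoP[a [b [_ _ e]]] e'; apply/funext => t; have [x <-] := th_surj t.
by have := congr1 (@^~ x) e; have := congr1 (@^~ x) e' => /= <-.
Qed.

Let affine_homeo (a b : R) : 0 < a -> Homeo_plus R R (fun x => a * x + b).
Proof.
move=> a0; split.
- by move=> x y xy; rewrite ltrD2r ltr_pM2l.
- by move=> x; apply: cvgD; [apply: cvgMl_tmp|exact: cvg_cst].
- exists (fun x => (x - b) / a); split=> [x|x|x].
  + by rewrite addrK mulrC mulKf ?gt_eqF.
  + by rewrite mulrC divfK ?subrK ?gt_eqF.
  + by apply: cvgMr_tmp; apply: cvgB => //; exact: cvg_cst.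
Qed.

Lemma affine_image : exists B : set (R -> R),
  [/\ homeo_subgroup B, B `<=` @Aff_plus R & semiconjugate G B].
Proof.
have G1 : G id by apply/GA; exists 1%g; apply/funext => x; rewrite act1.
have GM f g : G f -> G g -> G (f \o g).
  move=> /GA[f' ->] /GA[g' ->]; apply/GA; exists (f' * g')%g.
  by apply/funext => x; rewrite actM.
have rho1 : rho id = id by apply/esym/rho_uniq.
have rhoM f g : G f -> G g -> rho (f \o g) = rho f \o rho g.
  move=> Gf Gg; apply/esym/rho_uniq; first exact: GM.
  have [_ [_ [_ _ ef]]] := rhoP Gf; have [_ [_ [_ _ eg]]] := rhoP Gg.
  by rewrite compA ef -compA eg.
exists (rho @` G); split.
- split.
  + by move=> _ [f /rhoP[a [b [a0 -> _]]] <-]; exact: affine_homeo.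
  + by exists id.
  + by move=> _ _ [f Gf <-] [g Gg <-]; exists (f \o g); [exact: GM|exact: rhoM].
  + move=> _ w [f Gf <-] fw wf.
    have [g eg] := (GA f).1 Gf.
    have Gg : G (A g^-1%g) by apply/GA; exists g^-1%g.
    exists (A g^-1%g) => //; apply/funext => y; rewrite -[in LHS](wf y).
    (* The given inverse [w] is the image under [rho] of the inverse of [f], by multiplicativity
       evaluated at [w y]. *)
    rewrite -[LHS]/((rho (A g^-1%g) \o rho f) (w y)) -rhoM//.
    have -> : A g^-1%g \o f = id by rewrite eg; apply/funext => x; exact: actK.
    by rewrite rho1.
- move=> _ [f /rhoP[a [b [a0 -> _]]] <-]; split; first exact: affine_homeo.
  by exists a, b.
- exists rho, th; split=> //.
  + split=> //; first exact: mono_surj_continuous.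
    by apply/seteqP; split=> // t _; have [x <-] := th_surj t; exists x.
  + by move=> f /rhoP[a [b [_ _ ->]]].
Qed.

End AffineImage.

Theorem proposition5p9 (R : realType) (Gamma : set (unit_cc R -> unit_cc R))
    (hGamma : homeo_subgroup Gamma)
    (hmin : minimal_set (pullback_action (@incl_oo_cc R) Gamma) setT)
    (hfix : forall g : unit_cc R -> unit_cc R, Gamma g -> g <> id ->
      ([set x : unit_oo R | g (incl_oo_cc x) = incl_oo_cc x] #<= `I_3)%card)
    (phi : R -> unit_oo R) (hphi : Homeo_plus R (unit_oo R) phi) :
  exists A : set (R -> R),
    [/\ homeo_subgroup A, A `<=` @Aff_plus R &
        semiconjugate
          (pullback_action phi (pullback_action (@incl_oo_cc R) Gamma)) A].
Proof.
have [th [mono surj aff]] := affine_semiconjugacy (@line_act_dense _ _ hGamma hmin _ hphi hfix).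
exact: (@affine_image _ _ _ _ (@pullback_line_act _ _ hGamma _ hphi hfix) _ mono surj aff).
Qed.
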